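(* Let $\tilde\kappa>\frac1\pi$ be a constant independent of $\beta$, let $\beta>0$ and $\kappa=\tilde\kappa/\beta$ (so $\kappa>\frac{1}{\pi\beta}$), and let $\varphi_\beta$ be a minimizer of $F_{\beta,\kappa}$ in $\mathcal J$. Then, for $\beta>0$ small enough, there exists a unique $T\in(0,1)$ such that $\varphi_\beta(T)=\pi$, and $\varphi_\beta(x+T)=\pi+\varphi_\beta(x)$ for every $x\in[0,1-T]$. Setting $N:=E(1/T)$ (integer part), there exist constants $0<c<C$ independent of $\beta$ such that $\frac c\beta\le N\le\frac C\beta$. Furthermore, there exists a unique $\tilde\alpha_0$ with $0<\tilde\alpha_0\le 2\tilde\kappa$ such that $$\int_0^{\pi/2}\sqrt{\tilde\alpha_0^2+\sin^2y}\,dy=\tilde\kappa\pi,$$ and $$F_{\beta,\kappa}(\varphi_\beta)=-\frac{\tilde\alpha_0^2}{8\beta^2}+O_\beta\left(\frac1\beta\right).$$ Finally, letting $\tilde\varphi_\beta(x):=\varphi_\beta(\beta x)$ for $x\in[0,1/\beta]$, $\tilde\varphi_\beta$ converges in $\mathcal C^\infty(K)$ for every compact $K\subset[0,+\infty)$ to the solution $\varphi_0$ of $$\varphi_0''=\sin\varphi_0\cos\varphi_0\ \text{in }\mathbb R^+,\qquad \varphi_0(0)=0,\qquad \varphi_0'(0)=\tilde\alpha_0.$$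
   Context: For parameters $\beta>0$ and $\kappa>0$ define, for $\varphi\in H^1((0,1))$, $$F_{\beta,\kappa}(\varphi)=\frac18\int_0^1\left(\varphi'(x)^2+\frac{1}{\beta^2}\sin^2\varphi(x)\right)dx-\frac{\kappa}{2}\int_0^1\varphi'(x)\,dx,$$ and $\mathcal J=\{\varphi\in H^1((0,1)):\varphi(0)=0\}$. $E(\cdot)$ denotes the integer part. The notations $o_\beta$, $O_\beta$ refer to the limit $\beta\to0$. *)

(* Defs.v *)
From HB Require Import structures.
From mathcomp Require Import all_boot all_order all_algebra.
From mathcomp Require Import all_classical all_reals all_analysis.
Import Order.TTheory GRing.Theory Num.Theory.
Import numFieldNormedType.Exports.

Set Implicit Arguments.
Unset Strict Implicit.
Unset Printing Implicit Defensive.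

Local Open Scope classical_set_scope.
Local Open Scope ring_scope.

Section Defs.
Context {R : realType}.
Local Notation mu := (@lebesgue_measure R).
Local Notation I01 := (`[(0:R)%R, (1:R)%R]%classic : set R).

(* phi belongs to H^1((0,1)) with (weak) derivative g: g is in L^2(0,1)
   and phi is (its continuous representative) the primitive of g on [0,1]. *)
Definition H1_01 (phi g : R -> R) : Prop :=
  [/\ measurable_fun I01 g,
      (\int[mu]_(x in I01) ((g x) ^+ 2)%:E < +oo)%E,
      mu.-integrable I01 (EFin \o g)
    & forall x, 0 <= x <= 1 ->
        phi x = phi 0 + \int[mu]_(t in (`[0%R, x]%classic : set R)) g t].

(* The functional F_{beta,kappa}(phi), phi' being represented by g. *)
Definition Fbk (beta kappa : R) (phi g : R -> R) : R :=
  8^-1 * (\int[mu]_(x in I01) ((g x) ^+ 2 + (sin (phi x)) ^+ 2 / beta ^+ 2))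
  - kappa / 2 * (\int[mu]_(x in I01) g x).

Definition inJ (phi g : R -> R) : Prop := H1_01 phi g /\ phi 0 = 0.

Definition minimizer (beta kappa : R) (phi g : R -> R) : Prop :=
  inJ phi g /\ forall psi h, inJ psi h -> Fbk beta kappa phi g <= Fbk beta kappa psi h.

Definition deriv_within (S : set R) (f f' : R -> R) : Prop :=
  forall x, S x ->
    (fun y => (f y - f x) / (y - x)) @ within (fun y => S y /\ y <> x) (nbhs x)
      --> f' x.

Definition smooth_chain (S : set R) (D : nat -> R -> R) : Prop :=
  forall k, deriv_within S (D k) (D k.+1).

End Defs.

(* Main.v *)
(* Calibration.  Let q_a(s) = sqrt(a^2 + sin^2 s) ([speed]), let H_a be its
   primitive vanishing at 0 ([action]), and let v_a ([orbit]) be the solution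
   of v' = q_a(v), v(0) = 0, i.e. the inverse of the primitive of 1/q_a
   ([travel_time]); v_a solves v'' = sin v cos v with v'(0) = a.  Completing
   the square, every phi in J satisfies, with s = phi(1),

     8 beta^2 F(phi) = beta^2 int_0^1 (phi' - q_a(phi)/beta)^2
                       - a^2 + 2 beta (H_a(s) - 2 kt s).

   If phi is a minimizer, choose a so that v_a(1/beta) = s: comparing with
   v_a(x/beta), which has the same endpoint and no square term, gives
   phi(x) = v_a(x/beta); no first variation is needed.  For a = alpha0 the
   function H_a(s) - 2 kt s is pi-periodic, hence bounded; this gives the
   energy, and comparing with v_alpha0(x/beta) bounds the square term of the
   minimizer by O(1/beta), which forces a - alpha0 = O(sqrt beta).  The
   remaining claims are properties of v_a and of its dependence on a. *)
Require Import Defs.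
From HB Require Import structures.
From mathcomp Require Import all_boot all_order all_algebra.
From mathcomp Require Import all_classical all_reals all_analysis.
From mathcomp Require Import measurable_realfun.
From mathcomp Require Import ring lra.
Import Order.TTheory GRing.Theory Num.Theory.
Import numFieldNormedType.Exports.
Local Open Scope classical_set_scope.
Local Open Scope ring_scope.

Set Implicit Arguments.
Unset Strict Implicit.
Unset Printing Implicit Defensive.

(** * Comparison of increments and oriented primitives *)

Lemma derive_le_increment (R : realType) (F G f g : R -> R) (a b : R) : a <= b ->
  (forall x : R, is_derive x 1 F (f x)) -> (forall x : R, is_derive x 1 G (g x)) ->
  (forall x, a <= x -> x <= b -> f x <= g x) -> F b - F a <= G b - G a.
Proof.
move=> ab dF dG fg.
have dGF (x : R) : is_derive x 1 (G - F) (g x - f x) by exact: is_deriveB.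
have cGF : {within `[a, b], continuous (G - F)}.
  apply: continuous_subspaceT => x.
  by apply: differentiable_continuous; apply/derivable1_diffP; apply: ex_derive.
have [c] := MVT_segment ab (fun x _ => dGF x) cGF.
rewrite in_itv /= => /andP[ac cb].
  rewrite ![(G - F) _]/(_ - _) => e; rewrite -subr_ge0.
  have -> : G b - G a - (F b - F a) = G b - F b - (G a - F a) by ring.
  by rewrite e mulr_ge0 ?subr_ge0 // fg.
Qed.

Lemma derive_eq_increment (R : realType) (F G f : R -> R) :
  (forall x : R, is_derive x 1 F (f x)) -> (forall x : R, is_derive x 1 G (f x)) ->
  forall a b, F b - F a = G b - G a.
Proof.
move=> dF dG a b; wlog ab : a b / a <= b => [h|].
  by have /orP[/h//|/h] := le_total a b; lra.
by apply/eqP; rewrite eq_le !(derive_le_increment ab dF dG, derive_le_increment ab dG dF).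
Qed.

Lemma is_derive_continuous (R : realType) (F f : R -> R) :
  (forall x : R, is_derive x 1 F (f x)) -> continuous F.
Proof.
move=> dF x; apply: differentiable_continuous; apply/derivable1_diffP.
exact: ex_derive.
Qed.

Lemma continuous_integrable_itv (R : realType) (f : R -> R) (a b : R) : continuous f ->
  (@lebesgue_measure R).-integrable `[a, b] (EFin \o f).
Proof.
move=> cf; apply: continuous_compact_integrable; first exact: segment_compact.
exact: continuous_subspaceT.
Qed.

(* Oriented integral from 0 to x: one of the two sets is empty or a point. *)
Definition primitive (R : realType) (f : R -> R) (x : R) : R :=
  \int[@lebesgue_measure R]_(t in `[0, x]) f t -
  \int[@lebesgue_measure R]_(t in `[x, 0]) f t.

Lemma primitive0 (R : realType) (f : R -> R) : primitive f 0 = 0.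
Proof. by rewrite /primitive subrr. Qed.

Lemma is_derive_primitive (R : realType) (f : R -> R) (x : R) : continuous f ->
  is_derive x 1 (primitive f) (f x).
Proof.
(* With [b] strictly to the left of both 0 and [x], [primitive f] is near [x] the integral from [b]
   minus a constant, whatever the sign of [x]. *)
move=> cf; pose b := Num.min x 0 - 1.
have bx : b < x by rewrite /b; have := ge_min x x 0; rewrite lexx /=; lra.
have b0 : b < 0 by rewrite /b; have := ge_min 0 x 0; rewrite lexx orbT; lra.
have cfi (u v : R) := continuous_integrable_itv u v cf.
pose mu := @lebesgue_measure R.
have shift (u v : R) : b <= u -> u <= v ->
    \int[mu]_(t in `[b, v]) f t - \int[mu]_(t in `[b, u]) f t =
    \int[mu]_(t in `[u, v]) f t.
  move=> bu uv; rewrite Rintegral_itvB ?bnd_simp//.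
  rewrite Rintegral_itv_obnd_cbnd//.
  by apply: integrableS (cfi u v) => //; exact: subset_itv_oc_cc.
have E y : b < y -> primitive f y =
    \int[mu]_(t in `[b, y]) f t - \int[mu]_(t in `[b, 0]) f t.
  move=> yb; rewrite /primitive; have [y0|y0|->] := ltgtP y 0; last first.
  - by rewrite !subrr.
  - rewrite (@set_itv_ge _ _ (BLeft y)) ?bnd_simp -?ltNge//.
    by rewrite Rintegral_set0 subr0 shift ?ltW.
  - rewrite (@set_itv_ge _ _ (BLeft 0)) ?bnd_simp -?ltNge//.
    by rewrite Rintegral_set0 sub0r -(shift y 0) ?ltW// opprB.
have xu : x < x + 1 by rewrite ltrDl.
have [dI vI] := continuous_FTC1_closed xu (cfi b (x + 1)) bx (cf x).
have dI' : is_derive x 1 (fun y => \int[mu]_(t in `[b, y]) f t) (f x).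
  by apply: DeriveDef => //; rewrite -derive1E.
have dB := is_deriveB (is_derive_cst (\int[mu]_(t in `[b, 0]) f t) x (1 : R)).
have d2 : is_derive x 1 (fun y => \int[mu]_(t in `[b, y]) f t -
   \int[mu]_(t in `[b, 0]) f t) (f x).
  by rewrite -[f x]subr0; apply: is_deriveB.
apply: near_eq_is_derive d2.
by near=> y; apply/esym/E; near: y; exact: lt_nbhsr.
Unshelve. all: by end_near. Qed.

(** * Chain rule in H^1 *)

(** Cut [[0, x]] into n+1 equal pieces: the bounds telescope to |P x - P 0| <= x (B x - B 0) /
    (n+1), and n is arbitrary. *)
Lemma eq_of_superlinear_increment (R : realType) (P B : R -> R) (x : R) : 0 <= x ->
  (forall s t, 0 <= s -> s <= t -> t <= x -> `|P t - P s| <= (t - s) * (B t - B s)) ->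
  P x = P 0.
Proof.
move=> x0 PB.
have step n : `|P x - P 0| * n.+1%:R <= x * (B x - B 0).
  pose h := x / n.+1%:R.
  have h0 : 0 <= h by rewrite divr_ge0.
  have hn : h * n.+1%:R = x by rewrite /h divfK // pnatr_eq0.
  have main m : (m <= n.+1)%N -> `|P (h * m%:R) - P 0| <= h * (B (h * m%:R) - B 0).
    elim: m => [|m IH] mn; first by rewrite mulr0 !subrr normr0 mulr0.
    have hm : h * m.+1%:R = h * m%:R + h by rewrite -natr1; ring.
    have hmx : h * m.+1%:R <= x by rewrite -hn ler_wpM2l // ler_nat.
    have hm0 : 0 <= h * m%:R by rewrite mulr_ge0.
    have hmm : h * m%:R <= h * m.+1%:R by rewrite hm lerDl.
    have := PB _ _ hm0 hmm hmx; have := IH (ltnW mn).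
    rewrite (_ : h * m.+1%:R - h * m%:R = h); last by rewrite hm; ring.
    move=> h1 h2.
    have := ler_normD (P (h * m.+1%:R) - P (h * m%:R)) (P (h * m%:R) - P 0).
    rewrite (_ : _ - _ + (_ - _) = P (h * m.+1%:R) - P 0); last by ring.
    move=> /le_trans; apply; apply: (le_trans (lerD h2 h1)).
    by rewrite le_eqVlt; apply/orP; left; apply/eqP; ring.
  have := main n.+1 (leqnn _); rewrite hn => /(ler_wpM2r (ler0n _ n.+1)).
  by rewrite mulrAC hn.
apply/eqP; rewrite -subr_eq0 -normr_le0 leNgt; apply/negP => P0.
(* If [P x] and [P 0] differ, [step] bounds every n+1 by [z], against the Archimedean property. *)
pose z := x * (B x - B 0) / `|P x - P 0|.
have z0 : 0 <= z.
  have := step 0%N; rewrite mulr1 => /(le_trans (normr_ge0 _)) h.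
  by rewrite /z divr_ge0.
have := step (Num.bound z); apply/negP; rewrite -ltNge [ltRHS]mulrC -ltr_pdivrMr // -/z.
by rewrite (lt_le_trans (archi_boundP z0)) // ler_nat.
Qed.

(** The end points come in either order, and [c] is located only by its distance to [a]: this is the
    form needed for values of an H^1 function, which need not be monotone. *)
Lemma MVT_between (R : realType) (F f : R -> R) (a b : R) :
  (forall x : R, is_derive x 1 F (f x)) ->
  exists2 c, `|c - a| <= `|b - a| & F b - F a = f c * (b - a).
Proof.
move=> dF.
have cF u v : {within `[u, v], continuous F}.
  by apply: continuous_subspaceT; exact: is_derive_continuous dF.
have [ab|/ltW ba] := leP a b.
  have [c] := MVT_segment ab (fun x _ => dF x) (cF _ _).
  rewrite in_itv /= => /andP[ac cb] e; exists c => //.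
  by rewrite !ger0_norm ?subr_ge0 // lerB.
have [c] := MVT_segment ba (fun x _ => dF x) (cF _ _).
rewrite in_itv /= => /andP[ac cb] e; exists c.
  by rewrite !ler0_norm ?subr_le0 // lerN2 lerB.
by rewrite -opprB e; ring.
Qed.

Section H1.
Context {R : realType}.
Local Notation mu := (@lebesgue_measure R).

Lemma Rintegral_itv_split (f : R -> R) (a b c : R) : a <= b -> b <= c ->
  mu.-integrable `[a, c] (EFin \o f) ->
  \int[mu]_(t in `[a, c]) f t =
  \int[mu]_(t in `[a, b]) f t + \int[mu]_(t in `[b, c]) f t.
Proof.
move=> ab bc fi; apply/eqP; rewrite addrC -subr_eq.
rewrite Rintegral_itvB ?bnd_simp// Rintegral_itv_obnd_cbnd//.
by apply: integrableS fi => //; apply: subset_itvScc => //; rewrite bnd_simp.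
Qed.

Lemma Rintegral_itv_cst (a b r : R) : a <= b -> \int[mu]_(t in `[a, b]) r = r * (b - a).
Proof.
move=> ab; rewrite Rintegral_cst //=; have := @lebesgue_measure_itv R `[a, b]; rewrite /= lte_fin => ->.
by case: ltgtP ab => //= -> _; rewrite subrr.
Qed.

(** Integrate 2m|g| <= g^2 + m^2, where m is the mean of |g| over the interval. *)
Lemma Rintegral_cauchy_schwarz (g : R -> R) (x y : R) : x <= y ->
  mu.-integrable `[x, y] (EFin \o g) ->
  mu.-integrable `[x, y] (EFin \o (fun t => g t ^+ 2)) ->
  (\int[mu]_(t in `[x, y]) `|g t|) ^+ 2 <= (y - x) * \int[mu]_(t in `[x, y]) g t ^+ 2.
Proof.
move=> xy gi' g2i; have [xy'|] := ltP x y; last first.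
  move=> yx; have -> : y = x by apply/le_anti; rewrite yx.
  by rewrite set_itv1 !Rintegral_set1 subrr mul0r expr0n.
pose A := \int[mu]_(t in `[x, y]) `|g t|; rewrite -/A.
pose m := A / (y - x).
have gi := integrable_norm gi'.
have mci : mu.-integrable `[x, y] (EFin \o (fun _ => m ^+ 2)).
  by apply: continuous_integrable_itv => ?; exact: cvg_cst.
have zi : mu.-integrable `[x, y] (EFin \o (fun t => 2 * m * `|g t|)).
  exact: (integrableZl _ (2 * m) gi).
have si : mu.-integrable `[x, y] (EFin \o (fun t => g t ^+ 2 + m ^+ 2)).
  exact: (integrableD _ g2i mci).
have : \int[mu]_(t in `[x, y]) (2 * m * `|g t|) <= \int[mu]_(t in `[x, y]) (g t ^+ 2 + m ^+ 2).
  apply: le_Rintegral => // t _.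
  by rewrite -[g t ^+ 2]real_normK ?num_real// -subr_ge0; have := sqr_ge0 (`|g t| - m); lra.
rewrite RintegralZl // RintegralD // Rintegral_itv_cst // -/A.
have yx0 : 0 < y - x by rewrite subr_gt0.
have mA : A = m * (y - x) by rewrite /m divfK // gt_eqF.
rewrite [in X in X -> _]mA => h.
have -> : A ^+ 2 = (y - x) * (2 * m * (m * (y - x)) - m ^+ 2 * (y - x)) by rewrite mA; ring.
by apply: ler_wpM2l; [exact: ltW|lra].
Qed.

Variables (phi g : R -> R).
Hypothesis Hphi : H1_01 phi g.

Lemma H1_integrable (x y : R) : 0 <= x -> y <= 1 -> mu.-integrable `[x, y] (EFin \o g).
Proof.
case: Hphi => _ _ gi _ x0 y1.
by apply: integrableS gi => //; apply: subset_itvScc; rewrite bnd_simp.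
Qed.

Lemma H1_sqr_integrable (x y : R) : 0 <= x -> y <= 1 ->
  mu.-integrable `[x, y] (EFin \o (fun t => g t ^+ 2)).
Proof.
case: Hphi => mg g2 _ _ x0 y1.
suff h : mu.-integrable `[0, 1] (EFin \o (fun t => g t ^+ 2)).
  by apply: integrableS h => //; apply: subset_itvScc; rewrite bnd_simp.
apply/integrableP; split; first by apply/measurable_EFinP; exact: measurable_funX.
by under eq_integral do rewrite /= ger0_norm ?sqr_ge0 //.
Qed.

Lemma H1_increment (x y : R) : 0 <= x -> x <= y -> y <= 1 ->
  phi y - phi x = \int[mu]_(t in `[x, y]) g t.
Proof.
case: (Hphi) => _ _ _ E x0 xy y1.
rewrite (E y) ?(E x) ?x0 ?(le_trans x0 xy) ?y1 ?(le_trans xy y1) //.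
rewrite (Rintegral_itv_split x0 xy); last exact: H1_integrable.
by ring.
Qed.

Lemma H1_continuous : {within `[0, 1], continuous phi}.
Proof.
case: Hphi => _ _ gi E.
have := parameterized_integral_continuous ler01 gi => c.
have : {within `[0, 1], continuous (fun x => phi 0 + \int[mu]_(t in `[0, x]) g t)}.
  by move=> x; apply: cvgD; [exact: cvg_cst|exact: c].
apply: subspace_eq_continuous => x; rewrite inE /= in_itv /= => x01.
by rewrite /= [RHS]E.
Qed.

Lemma H1_comp_integrable (p : R -> R) (B x y : R) : continuous p ->
  (forall s, `|p s| <= B) -> 0 <= x -> y <= 1 ->
  mu.-integrable `[x, y] (EFin \o (fun t => p (phi t) * g t)).
Proof.
move=> cp pB x0 y1.
suff h : mu.-integrable `[0, 1] (EFin \o (fun t => p (phi t) * g t)).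
  by apply: integrableS h => //; apply: subset_itvScc; rewrite bnd_simp.
case: (Hphi) => mg _ gi _.
have mphi : measurable_fun (`[0, 1] : set R) phi.
  by apply: subspace_continuous_measurable_fun => //; exact: H1_continuous.
have Bgi : mu.-integrable `[0, 1] (EFin \o (fun t => B * `|g t|)).
  under [X in mu.-integrable _ X]funext => t do rewrite /= EFinM.
  by apply: integrableZl => //; exact: integrable_norm gi.
apply: le_integrable Bgi => //.
  apply/measurable_EFinP; apply: measurable_funM => //.
  by apply: measurableT_comp => //; exact: continuous_measurable_fun.
move=> t _ /=; rewrite lee_fin !normrM normr_id ler_wpM2r //.
by rewrite (le_trans (pB _)) // ler_norm.
Qed.

Lemma H1_cauchy_schwarz (x y : R) : 0 <= x -> x <= y -> y <= 1 ->
  (\int[mu]_(t in `[x, y]) `|g t|) ^+ 2 <= (y - x) * \int[mu]_(t in `[x, y]) g t ^+ 2.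
Proof.
move=> x0 xy y1; apply: Rintegral_cauchy_schwarz => //.
  exact: H1_integrable.
exact: H1_sqr_integrable.
Qed.

Lemma H1_increment_le (x y : R) : 0 <= x -> x <= y -> y <= 1 ->
  `|phi y - phi x| <= \int[mu]_(t in `[x, y]) `|g t|.
Proof.
move=> x0 xy y1; rewrite H1_increment //; apply: le_normr_Rintegral => //.
exact: H1_integrable.
Qed.

(* The increment of F o phi - int p(phi) g over [s, t] is quadratic in the
   L^1 norm of g there, hence o(t - s) by Cauchy-Schwarz: this replaces the
   a.e. differentiability of absolutely continuous functions. *)
Lemma H1_chain_rule (F p : R -> R) (K B x : R) : continuous p ->
  (forall s : R, is_derive s 1 F (p s)) -> 0 <= K ->
  (forall s t, `|p s - p t| <= K * `|s - t|) -> (forall s, `|p s| <= B) ->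
  0 <= x -> x <= 1 ->
  \int[mu]_(t in `[0, x]) (p (phi t) * g t) = F (phi x) - F (phi 0).
Proof.
move=> cp dF K0 pK pB x0 x1.
pose P t := F (phi t) - \int[mu]_(u in `[0, t]) (p (phi u) * g u).
pose Q t := 2 * K * \int[mu]_(u in `[0, t]) g u ^+ 2.
suff : P x = P 0 by rewrite /P set_itv1 Rintegral_set1; lra.
apply: (@eq_of_superlinear_increment _ _ Q) => // s t s0 st tx.
have t1 := le_trans tx x1; have t0 := le_trans s0 st.
have pgi := H1_comp_integrable cp pB.
rewrite /P /Q (Rintegral_itv_split s0 st (pgi _ _ (lexx 0) t1)).
rewrite (Rintegral_itv_split s0 st (H1_sqr_integrable (lexx 0) t1)).
set D := \int[mu]_(u in `[s, t]) `|g u|.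
(* Freezing p at the intermediate value [c] turns the increment of F o phi into an integral of p(c)
   g, to be compared with that of p(phi) g. *)
have [c cD Fc] := MVT_between (phi s) (phi t) dF.
have gi := H1_integrable s0 t1.
have pci : mu.-integrable `[s, t] (EFin \o (fun u => p c * g u)).
  exact: (integrableZl _ (p c) gi).
have E : F (phi t) - F (phi s) - \int[mu]_(u in `[s, t]) (p (phi u) * g u) =
    \int[mu]_(u in `[s, t]) (p c * g u - p (phi u) * g u).
  rewrite Fc (H1_increment s0 st t1) RintegralB // ?RintegralZl //; exact: pgi.
have di : mu.-integrable `[s, t] (EFin \o (fun u => p c * g u - p (phi u) * g u)).
  exact: (integrableB _ pci (pgi _ _ s0 t1)).
rewrite (_ : _ - _ - _ = \int[mu]_(u in `[s, t]) (p c * g u - p (phi u) * g u)); last first.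
  by rewrite -E; ring.
apply: (le_trans (le_normr_Rintegral _ di)) => //.
have D2 : D ^+ 2 <= (t - s) * \int[mu]_(u in `[s, t]) g u ^+ 2 by exact: H1_cauchy_schwarz.
apply: (@le_trans _ _ (2 * K * D ^+ 2)); last first.
  by have := ler_wpM2l (mulr_ge0 (ler0n R 2) K0) D2; lra.
have ni := integrable_norm gi.
have -> : 2 * K * D ^+ 2 = \int[mu]_(u in `[s, t]) (2 * K * D * `|g u|).
  by rewrite RintegralZl // -/D; ring.
apply: le_Rintegral => //; first exact: integrable_norm di.
  exact: (integrableZl _ (2 * K * D) ni).
move=> u; rewrite /= in_itv /= => /andP[su ut].
rewrite -mulrBl normrM ler_wpM2r //; apply: (le_trans (pK _ _)).
rewrite [2 * K]mulrC -mulrA ler_wpM2l //.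
(* Both [c] and [phi u] lie within [D] of [phi s], so the two values of p differ by at most 2KD. *)
have h1 : `|c - phi s| <= D by apply: (le_trans cD); exact: H1_increment_le.
have h2 : `|phi u - phi s| <= D.
  apply: (le_trans (H1_increment_le s0 su (le_trans ut t1))).
  rewrite /D (Rintegral_itv_split su ut ni) lerDl.
  by apply: Rintegral_ge0 => ? _ /=.
by have := ler_distD (phi s) c (phi u); rewrite [ `|phi s - _|]distrC; lra.
Qed.

End H1.

(** * Speed, action and orbits *)

Definition speed {R : realType} (a s : R) : R := Num.sqrt (a ^+ 2 + sin s ^+ 2).

Section Speed.
Context {R : realType}.
Implicit Types a b s t : R.

Lemma speed_arg_ge0 a s : 0 <= a ^+ 2 + sin s ^+ 2.
Proof. by rewrite addr_ge0 ?sqr_ge0. Qed.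

Lemma speed_ge0 a s : 0 <= speed a s. Proof. exact: sqrtr_ge0. Qed.

Lemma speed_sqr a s : speed a s ^+ 2 = a ^+ 2 + sin s ^+ 2.
Proof. by rewrite sqr_sqrtr // speed_arg_ge0. Qed.

Lemma speed_ge a s : 0 <= a -> a <= speed a s.
Proof.
by move=> a0; rewrite -[leLHS]ger0_norm // -sqrtr_sqr ler_wsqrtr // lerDl sqr_ge0.
Qed.

Lemma speed_gt0 a s : 0 < a -> 0 < speed a s.
Proof. by move=> a0; exact: lt_le_trans (speed_ge s (ltW a0)). Qed.

Lemma sin_sqr_le1 s : sin s ^+ 2 <= 1.
Proof. by have := cos2Dsin2 s; have := sqr_ge0 (cos s); lra. Qed.

Lemma speed_le a s : 0 <= a -> speed a s <= a + 1.
Proof.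
move=> a0; rewrite -[leRHS]ger0_norm ?addr_ge0 // -sqrtr_sqr ler_wsqrtr //.
by have := sin_sqr_le1 s; nra.
Qed.

Lemma speed_pi a s : speed a (s + pi) = speed a s.
Proof. by rewrite /speed sinDpi sqrrN. Qed.

Lemma speed_opp a s : speed a (- s) = speed a s.
Proof. by rewrite /speed sinN sqrrN. Qed.

Lemma sin_lipschitz s t : `|sin s - sin t| <= `|s - t|.
Proof.
have [c _ ->] := @MVT_between R sin cos t s (fun x => is_derive_sin x).
by rewrite normrM ler_piMl // ler_norml cos_geN1 cos_le1.
Qed.

(** Reverse triangle inequality for the Euclidean norms of (u, w) and (v, w). It gives the Lipschitz
    bounds of [speed] both in the position and in the parameter. *)
Lemma sqrt_sum_sqr_lipschitz (u v w : R) :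
  `|Num.sqrt (u ^+ 2 + w ^+ 2) - Num.sqrt (v ^+ 2 + w ^+ 2)| <= `|u - v|.
Proof.
pose q x := Num.sqrt (x ^+ 2 + w ^+ 2); rewrite -!/(q _).
have q0 x : 0 <= q x by exact: sqrtr_ge0.
wlog uv : u v / q u <= q v => [h|].
  have [/h//|/ltW /h] := leP (q u) (q v).
  by rewrite distrC [X in _ <= X]distrC.
rewrite distrC [leRHS]distrC ger0_norm ?subr_ge0 // lerBlDl.
have q2 x : q x ^+ 2 = x ^+ 2 + w ^+ 2 by rewrite sqr_sqrtr // addr_ge0 ?sqr_ge0.
have h : `|u| <= q u by rewrite -sqrtr_sqr ler_wsqrtr // lerDl sqr_ge0.
have n2 : `|v - u| ^+ 2 = (v - u) ^+ 2 by rewrite real_normK ?num_real.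
have n0 := normr_ge0 (v - u).
rewrite -(@ler_pXn2r _ 2) ?nnegrE ?q0 ?addr_ge0 // q2 sqrrD q2 n2.
have : u * (v - u) <= q u * `|v - u|.
  by apply: (le_trans (ler_norm _)); rewrite normrM ler_wpM2r.
nra.
Qed.

Lemma speed_lipschitz a s t : `|speed a s - speed a t| <= `|s - t|.
Proof.
apply: le_trans (sin_lipschitz s t).
by rewrite /speed ![a ^+ 2 + _]addrC; exact: sqrt_sum_sqr_lipschitz.
Qed.

Lemma speed_param_lipschitz a b s : `|speed a s - speed b s| <= `|a - b|.
Proof. exact: sqrt_sum_sqr_lipschitz. Qed.

(** Since q_b^2 - q_a^2 = b^2 - a^2 and q_a + q_b <= a + b + 2, the increment is at least (b - a)(a
    + b)/(a + b + 2), and t/(t + 2) increases with t. The bound is uniform in [s]. *)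
Lemma speed_param_increment_ge m a b s : 0 <= a -> a <= b -> 0 <= m -> m <= a + b ->
  m / (m + 2) * (b - a) <= speed b s - speed a s.
Proof.
move=> a0 ab m0 mab; have b0 := le_trans a0 ab.
have := speed_ge s a0; have := speed_ge s b0.
have := speed_le s a0; have := speed_le s b0; have := speed_sqr a s; have := speed_sqr b s.
set p := speed a s; set q := speed b s => q2 p2 q1 p1 bq ap.
have m2 : 0 < m + 2 by rewrite ltr_wpDl.
have e : (q - p) * (q + p) = (b - a) * (a + b).
  have -> : (q - p) * (q + p) = q ^+ 2 - p ^+ 2 by ring.
  by rewrite q2 p2; ring.
have [qp0|] := ltP 0 (q + p); last first.
  move=> qp; have -> : b = a by apply/le_anti; rewrite ab andbT; lra.
  by rewrite subrr mulr0 subr_ge0; lra.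
rewrite mulrAC ler_pdivrMr // -(ler_pM2r qp0).
have -> : (q - p) * (m + 2) * (q + p) = (b - a) * ((a + b) * (m + 2)).
  by rewrite mulrAC e; ring.
rewrite [m * _]mulrC -mulrA ler_wpM2l ?subr_ge0 //; nra.
Qed.

Lemma lipschitz_continuous (K : R) (p : R -> R) : 0 <= K ->
  (forall s t, `|p s - p t| <= K * `|s - t|) -> continuous p.
Proof.
move=> K0 pK x; have K1 : 0 < K + 1 by rewrite ltr_wpDl.
apply/cvgrPdist_lt => e e0; near=> y.
apply: (le_lt_trans (pK x y)).
apply: (@le_lt_trans _ _ ((K + 1) * `|x - y|)); first by rewrite ler_wpM2r // lerDl.
rewrite mulrC -ltr_pdivlMr //; near: y.
exact: (nbhsx_ballx x _ (divr_gt0 e0 K1)).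
Unshelve. all: by end_near. Qed.

Lemma speed_continuous a : continuous (speed a).
Proof.
by apply: (@lipschitz_continuous 1) => // s t; rewrite mul1r; exact: speed_lipschitz.
Qed.

Lemma speed_inv_lipschitz a s t : 0 < a ->
  `|(speed a s)^-1 - (speed a t)^-1| <= a ^- 2 * `|s - t|.
Proof.
move=> a0; have s0 := speed_gt0 s a0; have t0 := speed_gt0 t a0.
have -> : (speed a s)^-1 - (speed a t)^-1 =
    (speed a s * speed a t)^-1 * (speed a t - speed a s).
  by field; rewrite !gt_eqF.
rewrite normrM distrC; apply: ler_pM => //; last exact: speed_lipschitz.
have st0 : 0 < speed a s * speed a t by exact: mulr_gt0.
rewrite gtr0_norm ?invr_gt0 // lef_pV2 ?posrE ?exprn_gt0 // expr2.
by apply: ler_pM; rewrite ?speed_ge // ltW.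
Qed.

Lemma speed_inv_continuous a : 0 < a -> continuous (fun s => (speed a s)^-1).
Proof.
move=> a0; apply: (@lipschitz_continuous (a ^- 2)); first by rewrite invr_ge0 exprn_ge0 // ltW.
by move=> s t; exact: speed_inv_lipschitz.
Qed.

Lemma speed_inv_le a s : 0 < a -> `|(speed a s)^-1| <= a^-1.
Proof.
move=> a0; have s0 := speed_gt0 s a0.
by rewrite gtr0_norm ?invr_gt0 // lef_pV2 ?posrE // speed_ge // ltW.
Qed.

End Speed.

Lemma Rintegral_FTC2 {R : realType} (F f : R -> R) (a b : R) : a <= b ->
  (forall x : R, is_derive x 1 F (f x)) -> continuous f ->
  \int[@lebesgue_measure R]_(t in `[a, b]) f t = F b - F a.
Proof.
rewrite le_eqVlt => /predU1P[<- _ _|ab dF cf].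
  by rewrite set_itv1 Rintegral_set1 subrr.
have cF := is_derive_continuous dF.
rewrite /Rintegral (@continuous_FTC2 _ f F a b ab) //=.
- exact: continuous_subspaceT.
- split=> [x _||]; first exact: ex_derive.
  + by apply: cvg_at_right_filter; exact: cF.
  + by apply: cvg_at_left_filter; exact: cF.
- by move=> x _; rewrite derive1E derive_val.
Qed.

Lemma continuous_sqr {R : realType} (f : R -> R) : continuous f ->
  continuous (fun x => f x ^+ 2).
Proof.
move=> cf; have -> : (fun x => f x ^+ 2) = f * f by apply/funext => x; rewrite expr2.
by move=> x; apply: continuousM; exact: cf.
Qed.

(** Admits the rescaled orbits, which are C^1, as competitors. *)
Lemma H1_01_C1 {R : realType} (F f : R -> R) :
  (forall x : R, is_derive x 1 F (f x)) -> continuous f -> H1_01 F f.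
Proof.
move=> dF cf; split.
- by apply: measurable_funTS; exact: continuous_measurable_fun.
- have /integrableP[_] := continuous_integrable_itv 0 1 (continuous_sqr cf).
  by under eq_integral do rewrite /= ger0_norm ?sqr_ge0 //.
- exact: continuous_integrable_itv.
- by move=> x /andP[x0 _]; rewrite (Rintegral_FTC2 x0 dF cf); ring.
Qed.

(** Up to normalization, [action] and [travel_time] are incomplete elliptic integrals of the second
    and first kind. *)
Definition action {R : realType} (a : R) : R -> R := primitive (speed a).
Definition travel_time {R : realType} (a : R) : R -> R :=
  primitive (fun s => (speed a s)^-1).
(** For [a > 0] the travel time is a bijection of the line, so the default value 0 of [xget] is
    never taken. *)
Definition orbit {R : realType} (a x : R) : R := xget 0 [set s | travel_time a s = x].

Section Orbit.
Context {R : realType}.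
Implicit Types a s t x y beta : R.

Lemma is_derive_action a s : is_derive s 1 (action a) (speed a s).
Proof. by apply: is_derive_primitive; exact: speed_continuous. Qed.

Lemma is_derive_scale (k s : R) : is_derive s 1 (fun t => k * t) k.
Proof.
have h := is_deriveZ (f := id) k (is_derive_id s (1 : R)).
by apply: is_derive_eq; rewrite [k *: _]mulr1.
Qed.

Lemma action_increment_le a s t : 0 <= a -> s <= t ->
  action a t - action a s <= (a + 1) * (t - s).
Proof.
move=> a0 st.
have := derive_le_increment st (is_derive_action a) (is_derive_scale (a + 1)).
by rewrite mulrBr; apply=> x _ _; exact: speed_le.
Qed.

Lemma action_increment_ge a s t : 0 <= a -> s <= t ->
  a * (t - s) <= action a t - action a s.
Proof.
move=> a0 st.
have := derive_le_increment st (is_derive_scale a) (is_derive_action a).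
by rewrite mulrBr; apply=> x _ _; exact: speed_ge.
Qed.

Section PositiveSpeed.
Variable a : R.
Hypothesis a0 : 0 < a.

Lemma is_derive_travel_time s : is_derive s 1 (travel_time a) (speed a s)^-1.
Proof. by apply: is_derive_primitive; exact: speed_inv_continuous. Qed.

Lemma travel_time_continuous : continuous (travel_time a).
Proof. exact: is_derive_continuous is_derive_travel_time. Qed.

Lemma travel_time0 : travel_time a 0 = 0. Proof. exact: primitive0. Qed.

Lemma travel_time_increment_le s t : s <= t ->
  travel_time a t - travel_time a s <= a^-1 * (t - s).
Proof.
move=> st; have := derive_le_increment st is_derive_travel_time (is_derive_scale a^-1).
rewrite mulrBr; apply=> x _ _.
by rewrite lef_pV2 ?posrE ?speed_gt0 // speed_ge // ltW.
Qed.

Lemma travel_time_increment_ge s t : s <= t ->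
  (a + 1)^-1 * (t - s) <= travel_time a t - travel_time a s.
Proof.
move=> st; have := derive_le_increment st (is_derive_scale (a + 1)^-1) is_derive_travel_time.
rewrite mulrBr; apply=> x _ _.
have a1 : 0 < a + 1 by rewrite ltr_wpDl // ltW.
by rewrite lef_pV2 ?posrE ?speed_gt0 // speed_le // ltW.
Qed.

Lemma travel_time_increasing s t : s < t -> travel_time a s < travel_time a t.
Proof.
move=> st; rewrite -subr_gt0; apply: lt_le_trans (travel_time_increment_ge (ltW st)).
by rewrite mulr_gt0 ?invr_gt0 ?subr_gt0 // ltr_wpDl // ltW.
Qed.

Lemma travel_time_mono : {mono travel_time a : s t / s <= t}.
Proof. by apply: le_mono => s t; exact: travel_time_increasing. Qed.

Lemma travel_time_inj : injective (travel_time a).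
Proof. exact: inc_inj travel_time_mono. Qed.

(** The travel time has slope at least 1/(a+1), so its values at -M and M, with M = (a+1)|x|,
    enclose [x]. *)
Lemma travel_time_surj x : exists s, travel_time a s = x.
Proof.
pose M := (a + 1) * `|x|.
have a1 : 0 < a + 1 by rewrite ltr_wpDl // ltW.
have M0 : 0 <= M by rewrite mulr_ge0 // ltW.
have N0 : - M <= 0 by rewrite oppr_le0.
have h1 := travel_time_increment_ge M0; have h2 := travel_time_increment_ge N0.
have e : (a + 1)^-1 * M = `|x| by rewrite /M mulKf // gt_eqF.
rewrite travel_time0 !subr0 sub0r opprK e in h1 h2.
have NM := le_trans N0 M0.
have cT : {within `[- M, M], continuous (travel_time a)}.
  by apply: continuous_subspaceT; exact: travel_time_continuous.
have [|s _ <-] := @IVT _ (travel_time a) _ _ x NM cT; last by exists s.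
have := ler_norm x; have := ler_norm (- x); rewrite normrN => x1 x2.
rewrite ge_min le_max; apply/andP; split.
  by apply/orP; left; lra.
by apply/orP; right; lra.
Qed.

Lemma orbitK x : travel_time a (orbit a x) = x.
Proof. by rewrite /orbit; case: xgetP => //= h; have [s /h] := travel_time_surj x. Qed.

Lemma travel_timeK s : orbit a (travel_time a s) = s.
Proof. by apply: travel_time_inj; rewrite orbitK. Qed.

Lemma orbit0 : orbit a 0 = 0.
Proof. by rewrite -[X in orbit a X]travel_time0 travel_timeK. Qed.

Lemma is_derive_orbit x : is_derive x 1 (orbit a) (speed a (orbit a x)).
Proof.
rewrite -{1}(orbitK x) -[speed _ _]invrK; apply: is_derive_inverse.
- by near=> s; exact: travel_timeK.
- by near=> s; exact: travel_time_continuous.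
- exact: is_derive_travel_time.
- by rewrite invr_neq0 // gt_eqF // speed_gt0.
Unshelve. all: by end_near. Qed.

Lemma orbit_continuous : continuous (orbit a).
Proof. exact: is_derive_continuous is_derive_orbit. Qed.

Lemma orbit_ge0 x : 0 <= x -> 0 <= orbit a x.
Proof. by move=> x0; rewrite -travel_time_mono travel_time0 orbitK. Qed.

Lemma orbit_le x : 0 <= x -> orbit a x <= (a + 1) * x.
Proof.
move=> /[dup] x0 /orbit_ge0 /travel_time_increment_ge.
rewrite orbitK travel_time0 !subr0 mulrC ler_pdivrMr ?[x * _]mulrC //.
by rewrite ltr_wpDl // ltW.
Qed.

(** Second-order equation of the orbit: differentiating sqrt(a^2 + sin^2 v) gives sin v cos v v' /
    q_a(v), and v' = q_a(v) cancels the denominator. *)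
Lemma is_derive_speed_orbit x : is_derive x 1 (fun y => speed a (orbit a y))
  (sin (orbit a x) * cos (orbit a x)).
Proof.
have dv := is_derive_orbit x.
have ds : is_derive x 1 (fun y => sin (orbit a y)) (cos (orbit a x) * speed a (orbit a x)).
  exact: is_derive1_comp.
have dq : is_derive x 1 (fun y => a ^+ 2 + sin (orbit a y) ^+ 2)
    (2 * (sin (orbit a x) * cos (orbit a x)) * speed a (orbit a x)).
  have -> : (fun y => a ^+ 2 + sin (orbit a y) ^+ 2) =
      cst (a ^+ 2) + (fun y => sin (orbit a y)) * (fun y => sin (orbit a y)).
    by apply/funext => y; rewrite expr2.
  apply: is_derive_eq; rewrite /GRing.scale /=; ring.
have arg0 : 0 < a ^+ 2 + sin (orbit a x) ^+ 2 by rewrite ltr_wpDr ?sqr_ge0 // exprn_gt0.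
have dr := is_derive1_sqrt arg0.
have := is_derive1_comp (g := fun y => a ^+ 2 + sin (orbit a y) ^+ 2) dr dq.
set l := (X in is_derive _ _ _ X -> _) => h.
have -> : sin (orbit a x) * cos (orbit a x) = l; last exact: h.
rewrite /l -/(speed a (orbit a x)); field.
by rewrite gt_eqF // speed_gt0.
Qed.

(** The speed is pi-periodic, so both sides have the same derivative. Inverted, this becomes the
    quasi-periodicity of the orbit. *)
Lemma travel_time_pi s : travel_time a (s + pi) = travel_time a s + travel_time a pi.
Proof.
have d1 y : is_derive y 1 (fun s => travel_time a (s + pi)) (speed a y)^-1.
  have h : is_derive y 1 (fun s => s + pi) (1 : R).
    by rewrite -[X in is_derive _ _ _ X]addr0; apply: is_deriveD.
  have := is_derive1_comp (f := travel_time a) (g := fun s => s + pi)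
    (is_derive_travel_time (y + pi)) h.
  by rewrite speed_pi mulr1.
have := derive_eq_increment d1 is_derive_travel_time 0 s.
by rewrite add0r travel_time0; lra.
Qed.

Lemma orbit_pi x : orbit a (x + travel_time a pi) = orbit a x + pi.
Proof. by apply: travel_time_inj; rewrite travel_time_pi !orbitK. Qed.

Lemma inJ_orbit beta : inJ (fun x => orbit a (beta^-1 * x))
  (fun x => beta^-1 * speed a (orbit a (beta^-1 * x))).
Proof.
split; last by rewrite mulr0 orbit0.
apply: H1_01_C1 => [x|].
  rewrite mulrC.
  exact: is_derive1_comp (is_derive_orbit _) (is_derive_scale beta^-1 x).
have c1 : continuous (fun x => orbit a (beta^-1 * x)).
  move=> x; apply: (@continuous_comp _ _ _ (fun x => beta^-1 * x) (orbit a)).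
    exact: is_derive_continuous (is_derive_scale beta^-1) x.
  exact: orbit_continuous.
move=> x; apply: cvgM; first exact: cvg_cst.
apply: (@continuous_comp _ _ _ (fun x => orbit a (beta^-1 * x)) (speed a)) (c1 x) _.
exact: speed_continuous.
Qed.

End PositiveSpeed.

Local Notation mu := (@lebesgue_measure R).

Definition defect a beta (phi g : R -> R) : R :=
  \int[mu]_(x in `[0, 1]) (g x - beta^-1 * speed a (phi x)) ^+ 2.

Lemma defect_ge0 a beta (phi g : R -> R) : 0 <= defect a beta phi g.
Proof. by apply: Rintegral_ge0 => x _; exact: sqr_ge0. Qed.

Lemma defect_orbit a beta :
  defect a beta (fun x => orbit a (beta^-1 * x))
   (fun x => beta^-1 * speed a (orbit a (beta^-1 * x))) = 0.
Proof.
rewrite /defect; under eq_Rintegral do rewrite subrr expr0n.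
by rewrite Rintegral_itv_cst // mul0r.
Qed.

Lemma H1_comp_cont_integrable (p phi g : R -> R) : H1_01 phi g -> continuous p ->
  mu.-integrable `[0, 1] (EFin \o (fun t => p (phi t))).
Proof.
move=> H cp; apply: continuous_compact_integrable; first exact: segment_compact.
move=> x; apply: continuous_comp; first exact: H1_continuous H x.
exact: cp.
Qed.

Lemma chain_speed a (phi g : R -> R) x : inJ phi g -> 0 <= a -> 0 <= x -> x <= 1 ->
  \int[mu]_(t in `[0, x]) (speed a (phi t) * g t) = action a (phi x).
Proof.
move=> [H p0] a0 x0 x1.
have sB t : `|speed a t| <= a + 1 by rewrite ger0_norm ?speed_ge0 // speed_le.
have sl s t : `|speed a s - speed a t| <= 1 * `|s - t|.
  by rewrite mul1r speed_lipschitz.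
rewrite (H1_chain_rule H (@speed_continuous R a) (is_derive_action a) ler01 sl sB x0 x1).
by rewrite p0 /action primitive0 subr0.
Qed.

(** Completing the square leaves the cross term q_a(phi) phi', which the chain rule integrates to
    [action a (phi 1)]. The identity holds for every [a], so the same function can be tested against
    several parameters. *)
Lemma Fbk_defect a beta kt (phi g : R -> R) : 0 <= a -> 0 < beta -> inJ phi g ->
  8 * beta ^+ 2 * Fbk beta (kt / beta) phi g =
  beta ^+ 2 * defect a beta phi g - a ^+ 2
   + 2 * beta * (action a (phi 1) - 2 * kt * phi 1).
Proof.
move=> a0 b0 J; have [H p0] := J; have bn : beta != 0 by rewrite gt_eqF.
have gi := H1_integrable H (lexx 0) (lexx 1).
have g2i := H1_sqr_integrable H (lexx 0) (lexx 1).
have sB t : `|speed a t| <= a + 1 by rewrite ger0_norm ?speed_ge0 // speed_le.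
have qgi := H1_comp_integrable H (@speed_continuous R a) sB (lexx 0) (lexx 1).
have si : mu.-integrable `[0, 1] (EFin \o (fun t => sin (phi t) ^+ 2 / beta ^+ 2)).
  apply: (H1_comp_cont_integrable (p := fun s => sin s ^+ 2 / beta ^+ 2) H) => s.
  apply: cvgM; last exact: cvg_cst.
  exact: (continuous_sqr (@continuous_sin R)).
have ci : mu.-integrable `[0, 1] (EFin \o (fun _ => a ^+ 2 / beta ^+ 2)).
  by apply: continuous_integrable_itv => ?; exact: cvg_cst.
have gsi : mu.-integrable `[0, 1] (EFin \o (fun t => g t ^+ 2 + sin (phi t) ^+ 2 / beta ^+ 2)).
  exact: (integrableD _ g2i si).
have gsci : mu.-integrable `[0, 1] (EFin \o
    (fun t => g t ^+ 2 + sin (phi t) ^+ 2 / beta ^+ 2 + a ^+ 2 / beta ^+ 2)).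
  exact: (integrableD _ gsi ci).
have qi : mu.-integrable `[0, 1] (EFin \o (fun t => 2 / beta * (speed a (phi t) * g t))).
  exact: (integrableZl _ (2 / beta) qgi).
have -> : defect a beta phi g = \int[mu]_(t in `[0, 1])
   (g t ^+ 2 + sin (phi t) ^+ 2 / beta ^+ 2 + a ^+ 2 / beta ^+ 2
     - 2 / beta * (speed a (phi t) * g t)).
  apply: eq_Rintegral => t _.
  rewrite sqrrB exprMn speed_sqr; field; exact: bn.
rewrite RintegralB // RintegralD // (RintegralZl (2 / beta) _ qgi) // (chain_speed J) //.
rewrite Rintegral_itv_cst // /Fbk -(H1_increment H (lexx 0) ler01 (lexx 1)) p0.
by field.
Qed.

End Orbit.

(** * Dependence on the parameter *)

Section SpeedParam.
Context {R : realType}.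
Implicit Types a b s t x L beta : R.

Lemma action0 a : action a 0 = 0. Proof. exact: primitive0. Qed.

Lemma action_param_lipschitz a b x : 0 <= x ->
  `|action a x - action b x| <= x * `|a - b|.
Proof.
move=> x0; have main c d : action c x - action d x <= x * `|c - d|.
  have dG (s : R) : is_derive s 1 (fun t => action d t + `|c - d| * t) (speed d s + `|c - d|).
    exact: is_deriveD (is_derive_action d s) (is_derive_scale _ s).
  have := derive_le_increment x0 (is_derive_action c) dG.
  rewrite !action0 mulr0 => h; rewrite mulrC.
  suff : action c x - 0 <= action d x + `|c - d| * x - (0 + 0) by lra.
  apply: h => s _ _; rewrite -lerBlDl.
  exact: le_trans (ler_norm _) (speed_param_lipschitz c d s).
by rewrite ler_norml main andbT lerNl opprB (le_trans (main b a)) // distrC.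
Qed.

Lemma action_param_increasing a b x : 0 < x -> 0 <= a -> a < b -> action a x < action b x.
Proof.
move=> x0 a0 ab; have b0 := le_lt_trans a0 ab.
(* Uniform gap between the two speeds, from [speed_param_increment_ge] with m = b. *)
pose c := b / (b + 2) * (b - a).
have c0 : 0 < c by rewrite mulr_gt0 ?subr_gt0 // divr_gt0 // ltr_wpDl // ltW.
have dG (s : R) : is_derive s 1 (fun t => action a t + c * t) (speed a s + c).
  exact: is_deriveD (is_derive_action a s) (is_derive_scale _ s).
have := derive_le_increment (ltW x0) dG (is_derive_action b).
rewrite !action0 mulr0 => h.
have cx : 0 < c * x by exact: mulr_gt0.
suff : action a x + c * x - (0 + 0) <= action b x - 0 by lra.
apply: h => s _ _; rewrite -lerBrDl.
by apply: speed_param_increment_ge => //; [exact: ltW|exact: ltW|rewrite lerDr].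
Qed.

Lemma action_param_inj a b x : 0 < x -> 0 <= a -> 0 <= b ->
  action a x = action b x -> a = b.
Proof.
move=> x0 a0 b0 e; apply/eqP; case: ltgtP => // ab.
  by have := action_param_increasing x0 a0 ab; rewrite e ltxx.
by have := action_param_increasing x0 b0 ab; rewrite e ltxx.
Qed.

Lemma pi_half_gt0 : 0 < pi / 2 :> R. Proof. by rewrite divr_gt0 // pi_gt0. Qed.

(** At parameter 0 the speed is |sin|, whose integral over a quarter period is 1. This is the
    threshold in the hypothesis that kt exceeds 1/pi. *)
Lemma action0_pi_half : action 0 (pi / 2) <= 1 :> R.
Proof.
have dG (s : R) : is_derive s 1 (fun t => - cos t) (sin s).
  by rewrite -[sin s]opprK; apply: is_deriveN.
have := derive_le_increment (ltW pi_half_gt0) (is_derive_action 0) dG.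
rewrite action0 subr0 cos_pihalf cos0 oppr0 opprK add0r; apply=> s s0 s1.
rewrite /speed expr0n add0r sqrtr_sqr ger0_norm // sin_ge0_pi // s0 /=.
by have := pi_gt0 R; lra.
Qed.

(** Intermediate values on [0, 2 kt]: at 0 the action is at most 1 < kt pi, and at 2 kt it is at
    least 2 kt (pi/2) = kt pi. *)
Lemma action_param_ex (kt : R) : pi^-1 < kt ->
  exists a : R, [/\ 0 < a, a <= 2 * kt & action a (pi / 2) = kt * pi].
Proof.
move=> hk; have p0 := pi_gt0 R; have k1 : 1 < kt * pi by rewrite -ltr_pdivrMr // div1r.
have k0 : 0 < kt by apply: lt_trans hk; rewrite invr_gt0.
have cA : continuous (fun a => action a (pi / 2)).
  apply: (@lipschitz_continuous R (pi / 2)); first exact/ltW/pi_half_gt0.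
  by move=> s t; exact/action_param_lipschitz/ltW/pi_half_gt0.
have k2 : 0 <= 2 * kt by rewrite mulr_ge0 // ltW.
have [||a] := @IVT _ (fun a => action a (pi / 2)) 0 (2 * kt) (kt * pi) k2.
- exact: continuous_subspaceT.
- have h0 := action0_pi_half.
  have h1 := action_increment_ge k2 (ltW pi_half_gt0).
  rewrite action0 !subr0 in h1.
  by rewrite ge_min le_max; apply/andP; split; apply/orP; [left|right]; lra.
- rewrite in_itv /= => /andP[]; rewrite le_eqVlt => /predU1P[<- _ e|a0 a2 e].
    by have := action0_pi_half; rewrite e; lra.
  by exists a.
Qed.

(** The speed is pi-periodic and even: translation makes the increment over a period constant, and
    the reflection s -> pi - s splits it into two equal halves. *)
Lemma action_pi a s : action a (s + pi) = action a s + 2 * action a (pi / 2).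
Proof.
have d1 (y : R) : is_derive y 1 (fun s => action a (s + pi)) (speed a y).
  have h : is_derive y 1 (fun s => s + pi) (1 : R).
    by rewrite -[X in is_derive _ _ _ X]addr0; apply: is_deriveD.
  have := is_derive1_comp (f := action a) (g := fun s => s + pi) (is_derive_action a (y + pi)) h.
  by rewrite speed_pi mulr1.
have d2 (y : R) : is_derive y 1 (fun s => - action a (pi - s)) (speed a y).
  have h : is_derive y 1 (fun s => pi - s) (- 1 : R).
    by rewrite -[X in is_derive _ _ _ X]add0r; apply: is_deriveB.
  have := is_deriveN (is_derive1_comp (f := action a) (g := fun s => pi - s)
    (is_derive_action a (pi - y)) h).
  by rewrite mulrN1 opprK [pi - y]addrC speed_pi speed_opp.
have := derive_eq_increment d1 (is_derive_action a) 0 s.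
have := derive_eq_increment d2 (is_derive_action a) 0 (pi / 2).
rewrite add0r action0 subr0 (_ : pi - pi / 2 = pi / 2); last by field.
by lra.
Qed.

(* The calibration is chosen so that this oscillation is pi-periodic in s. *)
Lemma action_linear_bound a kt : 0 <= a -> 0 <= kt -> action a (pi / 2) = kt * pi ->
  forall s, 0 <= s -> `|action a s - 2 * kt * s| <= (a + 1 + 2 * kt) * pi.
Proof.
move=> a0 k0 e s s0; have p0 := pi_gt0 R.
have z0 : 0 <= s / pi by rewrite divr_ge0 // ltW.
have : s <= (Num.bound (s / pi))%:R * pi by rewrite -ler_pdivrMr // ltW // archi_boundP.
(* Induction on the number of periods covering [0, s]: crude bounds settle s <= pi, and a shift by
   pi leaves the oscillation unchanged. *)
move: (Num.bound _) => n; elim: n s s0 {z0} => [|n IH] s s0 sn.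
  have -> : s = 0 by apply/le_anti; rewrite s0 andbT; move: sn; rewrite mul0r.
  by rewrite action0 mulr0 subrr normr0 mulr_ge0 ?(ltW p0) // !addr_ge0 // mulr_ge0.
have [sp|/ltW ps] := leP s pi.
  have h1 := action_increment_le a0 s0; have h2 := action_increment_ge a0 s0.
  rewrite action0 !subr0 in h1 h2.
  have h3 : 0 <= a * s by exact: mulr_ge0.
  have h4 : (a + 1) * s <= (a + 1) * pi by rewrite ler_wpM2l // addr_ge0.
  have h5 : kt * s <= kt * pi by exact: ler_wpM2l.
  have h6 : 0 <= kt * s by exact: mulr_ge0.
  have h7 : 0 <= (a + 1) * pi by rewrite mulr_ge0 ?(ltW p0) // addr_ge0.
  have h8 : 0 <= kt * pi by rewrite mulr_ge0 // ltW.
  by rewrite ler_norml mulrDl; apply/andP; split; lra.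
have := IH (s - pi); rewrite subr_ge0 => /(_ ps).
have := action_pi a (s - pi); rewrite subrK e => ->.
rewrite (_ : action a (s - pi) + _ - _ = action a (s - pi) - 2 * kt * (s - pi)); last by ring.
by apply; move: sn; rewrite -natr1 mulrDl mul1r; lra.
Qed.

(** The difference of the inverse speeds is at most l^-2 |a - b|; the lower bound [l] keeps the
    parameters away from 0, where 1/q_a becomes singular. *)
Lemma travel_time_param_lipschitz l a b s : 0 < l -> l <= a -> l <= b -> 0 <= s ->
  `|travel_time a s - travel_time b s| <= (s * l ^- 2) * `|a - b|.
Proof.
move=> l0 + + s0; have main c d : l <= c -> l <= d ->
    travel_time c s - travel_time d s <= (s * l ^- 2) * `|c - d|.
  move=> lc ld; have c0 := lt_le_trans l0 lc; have d0 := lt_le_trans l0 ld.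
  pose k := l ^- 2 * `|c - d|.
  have dG (x : R) : is_derive x 1 (fun t => travel_time d t + k * t) ((speed d x)^-1 + k).
    exact: is_deriveD (is_derive_travel_time d0 x) (is_derive_scale _ x).
  have := derive_le_increment s0 (is_derive_travel_time c0) dG.
  rewrite !travel_time0 mulr0 => h.
  suff : travel_time c s - 0 <= travel_time d s + k * s - (0 + 0) by rewrite /k; lra.
  apply: h => x _ _; rewrite -lerBlDl.
  have sc := speed_gt0 x c0; have sd := speed_gt0 x d0.
  have -> : (speed c x)^-1 - (speed d x)^-1 =
      (speed c x * speed d x)^-1 * (speed d x - speed c x).
    by field; rewrite !gt_eqF.
  apply: (le_trans (ler_norm _)); rewrite normrM distrC.
  apply: ler_pM => //; last exact: speed_param_lipschitz.
  have cd0 : 0 < speed c x * speed d x by exact: mulr_gt0.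
  rewrite gtr0_norm ?invr_gt0 // lef_pV2 ?posrE ?exprn_gt0 // expr2.
  have := speed_ge x (ltW c0); have := speed_ge x (ltW d0) => h1 h2.
  by apply: ler_pM; lra.
move=> la lb; rewrite ler_norml main // andbT lerNl opprB (le_trans (main b a _ _)) //.
by rewrite distrC.
Qed.

(* Substituting s = l (e^u - 1) exhibits the logarithmic divergence as l -> 0. *)
Lemma travel_time_param_large s L : 0 < s -> 0 < L ->
  exists2 l, 0 < l & L <= travel_time l s.
Proof.
move=> s0 L0; have e1 : 0 < expR L - 1 by rewrite subr_gt0 expR_gt1.
pose l := s / (expR L - 1); have l0 : 0 < l by exact: divr_gt0.
exists l => //.
have d1 (u : R) : is_derive u 1 (fun u => travel_time l (l * (expR u - 1)))
    ((speed l (l * (expR u - 1)))^-1 * (l * expR u)).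
  have h : is_derive u 1 (fun u => l * (expR u - 1)) (l * expR u).
    have -> : (fun u => l * (expR u - 1)) = l *: (expR - cst 1) by [].
    by apply: is_derive_eq; rewrite subr0.
  exact: is_derive1_comp (is_derive_travel_time l0 _) h.
have := derive_le_increment (ltW L0) (is_derive_scale 1) d1.
rewrite expR0 subrr !mulr0 (travel_time0 l) !subr0 mul1r.
rewrite (_ : l * (expR L - 1) = s); last by rewrite /l divfK // gt_eqF.
apply=> u u0 _; set y := l * (expR u - 1).
have y0 : 0 <= y by rewrite mulr_ge0 ?(ltW l0) // subr_ge0 -[1]expR0 ler_expR.
rewrite mulrC ler_pdivlMr ?speed_gt0 // mul1r.
have -> : l * expR u = l + y by rewrite /y; ring.
(* As q_l(y) <= l + y = l e^u, the composed travel time has derivative at least 1 in u. *)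
have h1 : speed l y <= speed l 0 + y.
  have := ler_norm (speed l y - speed l 0); have := speed_lipschitz l y 0.
  by rewrite [ `|y - 0|]ger0_norm ?subr0 //; lra.
by rewrite (le_trans h1) // lerD2r /speed sin0 expr0n addr0 sqrtr_sqr ger0_norm // ltW.
Qed.

(** Intermediate values in the parameter: the time is at least L for a small [l], and at l + s/L it
    is at most s/(l + s/L) <= L. *)
Lemma travel_time_param_ex s L : 0 < s -> 0 < L ->
  exists2 a, 0 < a & travel_time a s = L.
Proof.
move=> s0 L0; have [l l0 Ll] := travel_time_param_large s0 L0.
(* Writing the parameter as l + |u| keeps it above [l] for all real u, so the map is Lipschitz on
   the whole line. *)
have cT : continuous (fun u : R => travel_time (l + `|u|) s).
  apply: (@lipschitz_continuous R (s * l ^- 2)).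
    by rewrite mulr_ge0 ?ltW // invr_gt0 exprn_gt0.
  move=> u v; have lu (w : R) : l <= l + `|w| by rewrite lerDl.
  have := travel_time_param_lipschitz l0 (lu u) (lu v) (ltW s0) => /le_trans; apply.
  rewrite ler_wpM2l ?mulr_ge0 ?invr_ge0 ?exprn_ge0 ?(ltW s0) ?(ltW l0) //.
  by rewrite (_ : _ - _ = `|u| - `|v|) ?ler_dist_dist //; ring.
have sL : 0 <= s / L by rewrite divr_ge0 // ltW.
have [||u _ e] := @IVT _ (fun u : R => travel_time (l + `|u|) s) 0 (s / L) L sL.
- exact: continuous_subspaceT.
- rewrite normr0 addr0 (ger0_norm sL) ge_min le_max Ll /= andbT; apply/orP; right.
  have h0 : 0 < l + s / L by rewrite ltr_wpDr.
  have := travel_time_increment_le h0 (ltW s0); rewrite travel_time0 !subr0 => /le_trans.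
  apply; rewrite mulrC ler_pdivrMr // mulrDr mulrCA divff ?gt_eqF // mulr1 lerDr.
  by rewrite mulr_ge0 // ltW.
- by exists (l + `|u|) => //; rewrite ltr_wpDr.
Qed.

End SpeedParam.

(** * Minimizers are orbits *)

Section Minimizer.
Context {R : realType}.
Local Notation mu := (@lebesgue_measure R).
Implicit Types a b s t x L beta : R.

Lemma Fbk_orbit kt a beta : 0 < a -> 0 < beta ->
  8 * beta ^+ 2 * Fbk beta (kt / beta) (fun x => orbit a (beta^-1 * x))
    (fun x => beta^-1 * speed a (orbit a (beta^-1 * x))) =
  - a ^+ 2 + 2 * beta * (action a (orbit a beta^-1) - 2 * kt * orbit a beta^-1).
Proof.
move=> a0 b0; rewrite (Fbk_defect kt (ltW a0) b0 (inJ_orbit a0 beta)) defect_orbit.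
by rewrite mulr0 add0r mulr1.
Qed.

Lemma defect_integrable a beta (phi g : R -> R) : 0 <= a -> 0 < beta -> H1_01 phi g ->
  mu.-integrable `[0, 1] (EFin \o (fun x => g x - beta^-1 * speed a (phi x))) /\
  mu.-integrable `[0, 1] (EFin \o (fun x => (g x - beta^-1 * speed a (phi x)) ^+ 2)).
Proof.
move=> a0 b0 H.
have gi := H1_integrable H (lexx 0) (lexx 1).
have g2i := H1_sqr_integrable H (lexx 0) (lexx 1).
have sB t : `|speed a t| <= a + 1 by rewrite ger0_norm ?speed_ge0 // speed_le.
have qgi := H1_comp_integrable H (@speed_continuous R a) sB (lexx 0) (lexx 1).
have qi := H1_comp_cont_integrable H (@speed_continuous R a).
have q2i := H1_comp_cont_integrable H (continuous_sqr (@speed_continuous R a)).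
split; first exact: (integrableB _ gi (integrableZl _ beta^-1 qi)).
have -> : (fun x => (g x - beta^-1 * speed a (phi x)) ^+ 2) =
    (fun x => g x ^+ 2 + beta ^- 2 * speed a (phi x) ^+ 2
       + (- 2 / beta) * (speed a (phi x) * g x)).
  by apply/funext => x; field; rewrite gt_eqF.
have i1 : mu.-integrable `[0, 1]
    (EFin \o (fun x => g x ^+ 2 + beta ^- 2 * speed a (phi x) ^+ 2)).
  exact: (integrableD _ g2i (integrableZl _ (beta ^- 2) q2i)).
exact: (integrableD _ i1 (integrableZl _ (- 2 / beta) qgi)).
Qed.

(** By Cauchy-Schwarz d = g - q_a(phi)/beta has zero L^1 norm. The chain rule for [travel_time]
    gives travel_time(phi x) = int g/q_a(phi), which differs from x/beta by at most a^-1 int |d| =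
    0. *)
Lemma defect0_orbit a beta (phi g : R -> R) : 0 < a -> 0 < beta -> inJ phi g ->
  defect a beta phi g <= 0 ->
  forall x, 0 <= x -> x <= 1 -> phi x = orbit a (beta^-1 * x).
Proof.
move=> a0 b0 [H p0] d0 x x0 x1; apply: (travel_time_inj a0); rewrite orbitK //.
have [di d2i] := defect_integrable (ltW a0) b0 H.
pose d t := g t - beta^-1 * speed a (phi t).
have sub f : mu.-integrable `[0, 1] (EFin \o f) -> mu.-integrable `[0, x] (EFin \o f).
  by apply: integrableS => //; apply: subset_itvScc; rewrite bnd_simp.
have dn0 : \int[mu]_(t in `[0, x]) `|d t| = 0.
  apply/eqP; rewrite -sqrf_eq0 eq_le sqr_ge0 andbT.
  apply: (le_trans (Rintegral_cauchy_schwarz x0 (sub _ di) (sub _ d2i))).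
  rewrite mulr_ge0_le0 ?subr_ge0 //; apply: le_trans d0.
  rewrite /defect (Rintegral_itv_split x0 x1 d2i) lerDl.
  by apply: Rintegral_ge0 => t _; exact: sqr_ge0.
have K0 : 0 <= a ^- 2 by rewrite invr_ge0 exprn_ge0 // ltW.
have pL s t := speed_inv_lipschitz s t a0.
have pB s := speed_inv_le s a0.
have := H1_chain_rule H (speed_inv_continuous a0) (is_derive_travel_time a0) K0 pL pB x0 x1.
rewrite p0 travel_time0 // subr0 => <-; apply/eqP.
have pgi := H1_comp_integrable H (speed_inv_continuous a0) pB (lexx 0) x1.
have ci : mu.-integrable `[0, x] (EFin \o (fun _ => beta^-1)).
  by apply: continuous_integrable_itv => ?; exact: cvg_cst.
have e : \int[mu]_(t in `[0, x]) beta^-1 = beta^-1 * x.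
  by rewrite Rintegral_itv_cst // subr0.
rewrite -e -subr_eq0 -RintegralB // -normr_le0.
have pdi := integrableB _ pgi ci.
apply: (le_trans (le_normr_Rintegral _ (pdi _))) => //.
have ni := integrable_norm (sub _ di).
have dn1 : \int[mu]_(t in `[0, x]) (a^-1 * `|d t|) = 0 by rewrite RintegralZl // dn0 mulr0.
rewrite -[leRHS]dn1.
apply: le_Rintegral => //.
- exact: integrable_norm (pdi _).
- exact: (integrableZl _ a^-1 ni).
move=> t _; have st := speed_gt0 (phi t) a0.
have -> : (speed a (phi t))^-1 * g t - beta^-1 = (speed a (phi t))^-1 * d t.
  by rewrite /d; field; rewrite !gt_eqF.
by rewrite normrM ler_wpM2r // pB.
Qed.

Variables (kt alpha : R).
Hypothesis kt0 : 0 < kt.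
Hypothesis alpha0 : 0 < alpha.
Hypothesis alphaE : action alpha (pi / 2) = kt * pi.

(** The bound of [action_linear_bound] at the calibrated parameter. *)
Definition oscillation : R := (alpha + 1 + 2 * kt) * pi.

(** The factor of [speed_param_increment_ge] with m = alpha, valid whichever of [a] and [alpha] is
    larger. *)
Definition rigidity : R := alpha / (alpha + 2).

Lemma oscillation_gt0 : 0 < oscillation.
Proof. by rewrite mulr_gt0 ?pi_gt0 // !addr_gt0 // mulr_gt0. Qed.

Lemma rigidity_gt0 : 0 < rigidity.
Proof. by rewrite divr_gt0 // addr_gt0. Qed.

(** On the rescaled orbit of [a] the integrand is ((q_a - q_alpha)/beta)^2, and the gap between the
    speeds is bounded below uniformly in position. *)
Lemma defect_orbit_ge a beta : 0 < a -> 0 < beta ->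
  (rigidity * (a - alpha)) ^+ 2 <=
  beta ^+ 2 * defect alpha beta (fun x => orbit a (beta^-1 * x))
    (fun x => beta^-1 * speed a (orbit a (beta^-1 * x))).
Proof.
move=> a0 b0; have J := inJ_orbit a0 beta.
have [_ d2i] := defect_integrable (ltW alpha0) b0 (proj1 J).
pose c := beta ^- 2 * (rigidity * (a - alpha)) ^+ 2.
have -> : (rigidity * (a - alpha)) ^+ 2 = beta ^+ 2 * c.
  by rewrite /c mulVKf // sqrf_eq0 gt_eqF.
rewrite ler_wpM2l ?sqr_ge0 //.
have -> : c = \int[mu]_(x in `[0, 1]) c by rewrite Rintegral_itv_cst // subr0 mulr1.
apply: le_Rintegral => //; first by apply: continuous_integrable_itv => ?; exact: cvg_cst.
move=> x _; set s := orbit _ _; rewrite /c -exprVn -mulrBr [leRHS]exprMn.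
rewrite ler_wpM2l ?sqr_ge0 //.
have [h|/ltW h] := leP a alpha.
  have := @speed_param_increment_ge R alpha a alpha s (ltW a0) h (ltW alpha0).
  rewrite lerDr (ltW a0) => /(_ isT); rewrite -/rigidity => h1.
  rewrite -sqrrN -mulrN opprB -[leRHS]sqrrN opprB.
  by rewrite ler_pXn2r // nnegrE ?(le_trans _ h1) // mulr_ge0 ?subr_ge0 // ltW ?rigidity_gt0.
have := @speed_param_increment_ge R alpha alpha a s (ltW alpha0) h (ltW alpha0).
rewrite lerDl (ltW a0) => /(_ isT); rewrite -/rigidity => h1.
by rewrite ler_pXn2r // nnegrE ?(le_trans _ h1) // mulr_ge0 ?subr_ge0 // ltW ?rigidity_gt0.
Qed.

Lemma minimizer_orbit beta (phi g : R -> R) : 0 < beta ->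
  2 * beta * oscillation < alpha ^+ 2 -> minimizer beta (kt / beta) phi g ->
  exists a : R, [/\ 0 < a, (rigidity * (a - alpha)) ^+ 2 <= 4 * beta * oscillation,
    forall x : R, 0 <= x -> x <= 1 -> phi x = orbit a (beta^-1 * x) &
    `|8 * beta ^+ 2 * Fbk beta (kt / beta) phi g + alpha ^+ 2| <= 2 * beta * oscillation].
Proof.
move=> b0 small [J min].
have b2 : 0 < 8 * beta ^+ 2 by rewrite mulr_gt0 // exprn_gt0.
have bV : 0 < beta^-1 by rewrite invr_gt0.
have osc := action_linear_bound (ltW alpha0) (ltW kt0) alphaE.
have bosc s : 0 <= s ->
    `|2 * beta * (action alpha s - 2 * kt * s)| <= 2 * beta * oscillation.
  by move=> /osc h; rewrite normrM [ `|2 * beta|]gtr0_norm ?mulr_gt0 // ler_pM2l // mulr_gt0.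
set E := 8 * beta ^+ 2 * _.
(* Competitor: the rescaled orbit of [alpha], which has no square term. *)
have up : E <= - alpha ^+ 2 + 2 * beta * oscillation.
  have := min _ _ (inJ_orbit alpha0 beta); rewrite -(ler_pM2l b2) => /le_trans; apply.
  rewrite Fbk_orbit // lerD2l; apply: le_trans (bosc _ _); first exact: ler_norm.
  by apply: orbit_ge0; rewrite ?ltW.
(* If phi(1) <= 0 every term of the functional is nonnegative, whereas [up] and [small] make [E]
   negative. *)
have s0 : 0 < phi 1.
  rewrite ltNge; apply/negP => s0; have : 0 <= E.
    rewrite /E pmulr_rge0 // /Fbk subr_ge0.
    have [H p0] := J; rewrite -(H1_increment H (lexx 0) ler01 (lexx 1)) p0 subr0.
    apply: (@le_trans _ _ 0); first by rewrite mulr_ge0_le0 // divr_ge0 // divr_ge0 // ltW.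
    rewrite mulr_ge0 ?invr_ge0 //; apply: Rintegral_ge0 => x _.
    by rewrite addr_ge0 ?sqr_ge0 // divr_ge0 ?sqr_ge0.
  by move=> E0; lra.
(* The parameter whose orbit reaches phi(1) at time 1/beta. The energies of that orbit and of [phi]
   then differ only by the square term of [phi], which minimality forces to vanish. *)
have [a a0 aE] := travel_time_param_ex s0 bV.
have va : orbit a beta^-1 = phi 1 by rewrite -aE travel_timeK.
have d0 : defect a beta phi g <= 0.
  have := min _ _ (inJ_orbit a0 beta); rewrite -(ler_pM2l b2).
  rewrite Fbk_orbit // va (Fbk_defect kt (ltW a0) b0 J) => h.
  have : beta ^+ 2 * defect a beta phi g <= 0 by lra.
  by rewrite pmulr_rle0 // exprn_gt0.
have {}d0 : defect a beta phi g = 0 by apply/le_anti; rewrite d0 defect_ge0.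
exists a; split => //.
(* The orbit of [a] has energy [E]. Calibrating it with [alpha] and using [up], its square term is
   bounded by two oscillation terms, whence the factor 4. *)
- apply: (le_trans (defect_orbit_ge a0 b0)).
  have e1 := Fbk_orbit kt a0 b0.
  have e2 := Fbk_defect kt (ltW alpha0) b0 (inJ_orbit a0 beta).
  have e3 := Fbk_defect kt (ltW a0) b0 J.
  rewrite -/E d0 in e3; rewrite va in e1; rewrite e1 mulr1 va in e2.
  have := bosc _ (ltW s0); rewrite ler_norml => /andP[h1 h2].
  rewrite mulr0 add0r in e3; lra.
- by apply: (defect0_orbit a0 b0 J); rewrite d0.
- have e3 := Fbk_defect kt (ltW alpha0) b0 J; rewrite -/E in e3.
  have := bosc _ (ltW s0); rewrite !ler_norml => /andP[h1 h2].
  have h3 : 0 <= beta ^+ 2 * defect alpha beta phi g by rewrite mulr_ge0 ?sqr_ge0 ?defect_ge0.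
  by apply/andP; split; lra.
Qed.

End Minimizer.

(** * Derivatives of all orders *)

Section DerivWithin.
Context {R : realType}.
Implicit Types (S : set R) (f g : R -> R).

Lemma deriv_within_is_derive S f (f' : R -> R) : (forall x : R, is_derive x 1 f (f' x)) ->
  deriv_within S f f'.
Proof.
move=> df x _; have /is_derive1_caratheodory [h [hE hc <-]] := df x.
apply: (@cvg_trans _ (h @ within (fun y => S y /\ y <> x) (nbhs x))).
  apply: near_eq_cvg; rewrite near_withinE; near=> y => -[_ yx].
  by rewrite hE mulfK // subr_eq0; exact/eqP.
by apply: cvg_trans hc; apply: cvg_app; exact: cvg_within.
Unshelve. all: by end_near. Qed.

(** The accumulation hypothesis makes the punctured filter at [x] proper, so that limits along it
    are unique. *)
Lemma deriv_within_unique S f g (f' g' : R -> R) (x : R) : S x ->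
  (forall e, 0 < e -> exists y, [/\ S y, y <> x & `|x - y| < e]) ->
  {in S, f =1 g} -> deriv_within S f f' -> deriv_within S g g' -> f' x = g' x.
Proof.
move=> Sx acc fg df dg.
have PF : ProperFilter (within (fun y => S y /\ y <> x) (nbhs x)).
  apply: Build_ProperFilter_ex => A; rewrite /within /= => /nbhs_ballP[e e0 eA].
  by have [y [Sy yx ye]] := acc e e0; exists y; exact: eA.
have := df x Sx; have := dg x Sx => h1 h2.
apply/esym; apply: (@norm_cvg_unique _ _ _ _ _ _ h1 _); apply: cvg_trans h2.
apply: near_eq_cvg; rewrite near_withinE; near=> y => -[Sy _].
by rewrite !fg ?inE.
Unshelve. all: by end_near. Qed.

Lemma itv01_accumulation (x : R) : `[0, 1]%classic x ->
  forall e, 0 < e -> exists y : R, [/\ `[0, 1]%classic y, y <> x & `|x - y| < e].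
Proof.
rewrite /= in_itv /= => /andP[x0 x1] e e0.
pose d := Num.min (e / 2) (1 / 2).
have d0 : 0 < d by rewrite lt_min !divr_gt0.
have de : d < e.
  have : d <= e / 2 by rewrite ge_min lexx.
  by lra.
have d1 : d <= 1 / 2 by rewrite ge_min lexx orbT.
have [xh|hx] := leP x (1 / 2).
  exists (x + d); split; first by rewrite /= in_itv /=; apply/andP; split; lra.
    by lra.
  by rewrite opprD addrA subrr sub0r normrN gtr0_norm.
exists (x - d); split; first by rewrite /= in_itv /=; apply/andP; split; lra.
  by lra.
by rewrite opprD opprK addrA subrr add0r gtr0_norm.
Qed.

(** Allows an arbitrary chain of derivatives of a minimizer to be replaced by the explicit one built
    from jets. *)
Lemma smooth_chain_unique (D E : nat -> R -> R) :
  smooth_chain `[0, 1] D -> smooth_chain `[0, 1] E ->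
  (forall x, 0 <= x -> x <= 1 -> D 0%N x = E 0%N x) ->
  forall k x, 0 <= x -> x <= 1 -> D k x = E k x.
Proof.
move=> cD cE DE0; elim=> [//|k IH] x x0 x1.
have xI : `[0, 1]%classic x by rewrite /= in_itv /= x0.
apply: (deriv_within_unique xI (itv01_accumulation xI) _ (cD k) (cE k)).
by move=> y; rewrite inE /= in_itv /= => /andP[]; exact: IH.
Qed.

Lemma deriv_within_ray_is_derive f (f' : R -> R) (x : R) : deriv_within `[0, +oo[ f f' -> 0 < x ->
  is_derive x 1 f (f' x).
Proof.
move=> df x0; apply/is_derive1_caratheodory.
exists (fun y => if y == x then f' x else (f y - f x) / (y - x)).
rewrite eqxx; split=> // [z|].
  case: eqVneq => [->|zx]; first by rewrite !subrr mulr0.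
  by rewrite divfK // subr_eq0.
have xI : `[0, +oo[%classic x by rewrite /= in_itv /= ltW.
apply/cvgrPdist_lt => e e0; rewrite eqxx; near=> y.
case: eqVneq => [_|yx]; first by rewrite subrr normr0.
have : (fun y => `[0, +oo[%classic y /\ y <> x) y.
  split; last exact/eqP.
  by rewrite /= in_itv /= andbT ltW //; near: y; exact: lt_nbhsr.
near: y; have := df x xI => /cvgrPdist_lt /(_ e e0).
by rewrite near_withinE.
Unshelve. all: by end_near. Qed.

Lemma deriv_within_ray_continuous f (f' : R -> R) : deriv_within `[0, +oo[ f f' ->
  {within `[0, +oo[, continuous f}.
Proof.
move=> df; apply/continuous_within_itvcyP; split.
  move=> x; rewrite in_itv /= andbT => x0.
  apply: differentiable_continuous; apply/derivable1_diffP.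
  by case: (deriv_within_ray_is_derive df x0).
have I0 : `[(0 : R), +oo[%classic (0 : R) by rewrite /= in_itv /= lexx.
have q : (fun y => (f y - f 0) / (y - 0)) @ 0^'+ --> f' 0.
  apply/cvgrPdist_lt => e e0; have := df 0 I0 => /cvgrPdist_lt /(_ e e0).
  rewrite /at_right !near_withinE; move=> h; near=> y => y0.
  have yI : `[(0 : R), +oo[%classic y /\ y <> 0.
    split; first by rewrite /= in_itv /= andbT ltW.
    by move=> y00; rewrite y00 ltxx in y0.
  by move: yI; near: y; exact: h.
have i : (fun y : R => y) @ (0 : R)^'+ --> (0 : R) by apply: cvg_at_right_filter; exact: cvg_id.
have c0 : (fun=> f 0) @ (0 : R)^'+ --> f 0 by exact: cvg_cst.
(* Right continuity at 0: f is recovered as f(0) plus the difference quotient times y. *)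
have h : (fun y => f 0 + (f y - f 0) / (y - 0) * y) @ (0 : R)^'+ --> f 0 + f' 0 * 0.
  exact: cvgD c0 (cvgM q i).
rewrite mulr0 addr0 in h.
apply: cvg_trans h; apply: near_eq_cvg; near=> y => /=.
have y0 : 0 < y by near: y; exact: nbhs_right_gt.
by rewrite subr0 divfK ?gt_eqF // addrC subrK.
Unshelve. all: by end_near. Qed.

End DerivWithin.

(* Polynomials in u, sin u, cos u and w, closed under the derivation
   u' = w, w' = sin u cos u, hence containing every derivative of u. *)
Inductive jet : Type :=
  JPos | JSin | JCos | JVel | JAdd of jet & jet | JMul of jet & jet | JOpp of jet.

Fixpoint jet_eval {R : realType} (j : jet) (u w : R) : R :=
  match j with
  | JPos => u
  | JSin => sin u
  | JCos => cos u
  | JVel => w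
  | JAdd i j => jet_eval i u w + jet_eval j u w
  | JMul i j => jet_eval i u w * jet_eval j u w
  | JOpp j => - jet_eval j u w
  end.

Fixpoint jet_deriv (j : jet) : jet :=
  match j with
  | JPos => JVel
  | JSin => JMul JCos JVel
  | JCos => JOpp (JMul JSin JVel)
  | JVel => JMul JSin JCos
  | JAdd i j => JAdd (jet_deriv i) (jet_deriv j)
  | JMul i j => JAdd (JMul i (jet_deriv j)) (JMul j (jet_deriv i))
  | JOpp j => JOpp (jet_deriv j)
  end.

Section Jet.
Context {R : realType}.
Implicit Types (u w : R -> R) (a beta : R).

Lemma is_derive_jet u w (j : jet) : (forall x : R, is_derive x 1 u (w x)) ->
  (forall x : R, is_derive x 1 w (sin (u x) * cos (u x))) ->
  forall x : R, is_derive x 1 (fun y => jet_eval j (u y) (w y))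
    (jet_eval (jet_deriv j) (u x) (w x)).
Proof.
move=> du dw x; elim: j => /= [||||i IHi j IHj|i IHi j IHj|j IHj].
- exact: du.
- exact: is_derive1_comp (is_derive_sin _) (du x).
- by rewrite -mulNr; exact: is_derive1_comp (is_derive_cos _) (du x).
- exact: dw.
- exact: is_deriveD.
- exact: is_deriveM.
- exact: is_deriveN.
Qed.

(** One constant serves as bound and as Lipschitz constant on the box, so the induction passes
    through products: K and L combine to 2KL. *)
Lemma jet_eval_lipschitz (j : jet) (B : R) : exists2 K : R, 0 <= K &
  forall u1 w1 u2 w2 : R, `|u1| <= B -> `|w1| <= B -> `|u2| <= B -> `|w2| <= B ->
    `|jet_eval j u1 w1| <= K /\
    `|jet_eval j u1 w1 - jet_eval j u2 w2| <= K * (`|u1 - u2| + `|w1 - w2|).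
Proof.
elim: j => /= [||||i [K K0 hK] j [L L0 hL]|i [K K0 hK] j [L L0 hL]|j [L L0 hL]].
- exists (`|B| + 1) => [|u1 w1 u2 w2 b1 b2 b3 b4]; first by rewrite addr_ge0.
  have := ler_norm B; have := normr_ge0 B; have := normr_ge0 (u1 - u2).
  have := normr_ge0 (w1 - w2); split; [lra|nra].
- exists 1 => // u1 w1 u2 w2 _ _ _ _; split; first by rewrite ler_norml sin_geN1 sin_le1.
  by rewrite mul1r (le_trans (sin_lipschitz _ _)) // lerDl.
- exists 1 => // u1 w1 u2 w2 _ _ _ _; split; first by rewrite ler_norml cos_geN1 cos_le1.
  rewrite mul1r; apply: (@le_trans _ _ `|u1 - u2|); last by rewrite lerDl.
  have [c _ ->] := @MVT_between R cos (fun x => - sin x) u2 u1 (fun x => is_derive_cos x).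
  by rewrite normrM normrN ler_piMl // ler_norml sin_geN1 sin_le1.
- exists (`|B| + 1) => [|u1 w1 u2 w2 b1 b2 b3 b4]; first by rewrite addr_ge0.
  have := ler_norm B; have := normr_ge0 B; have := normr_ge0 (u1 - u2).
  have := normr_ge0 (w1 - w2); split; [lra|nra].
- exists (K + L) => [|u1 w1 u2 w2 b1 b2 b3 b4]; first by rewrite addr_ge0.
  have [k1 k2] := hK _ _ _ _ b1 b2 b3 b4; have [l1 l2] := hL _ _ _ _ b1 b2 b3 b4.
  split; first by rewrite (le_trans (ler_normD _ _)) // lerD.
  rewrite opprD addrACA mulrDl.
  by rewrite (le_trans (ler_normD _ _)) // lerD.
- exists (2 * (K * L)) => [|u1 w1 u2 w2 b1 b2 b3 b4]; first by rewrite !mulr_ge0.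
  have [k1 k2] := hK _ _ _ _ b1 b2 b3 b4; have [l1 l2] := hL _ _ _ _ b1 b2 b3 b4.
  have [k3 _] := hK _ _ _ _ b3 b4 b1 b2.
  have KL : 0 <= K * L by exact: mulr_ge0.
  split.
    rewrite normrM; apply: (@le_trans _ _ (K * L)); first by rewrite ler_pM.
    by rewrite ler_peMl // ler1n.
  rewrite (_ : _ - _ = (jet_eval i u1 w1 - jet_eval i u2 w2) * jet_eval j u1 w1 +
     jet_eval i u2 w2 * (jet_eval j u1 w1 - jet_eval j u2 w2)); last by ring.
  apply: (le_trans (ler_normD _ _)); rewrite !normrM.
  set d := `|u1 - u2| + `|w1 - w2| in k2 l2 *.
  have -> : 2 * (K * L) * d = K * d * L + K * (L * d) by ring.
  by apply: lerD; apply: ler_pM.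
- exists L => // u1 w1 u2 w2 b1 b2 b3 b4.
  have [l1 l2] := hL _ _ _ _ b1 b2 b3 b4.
  by rewrite -opprD !normrN.
Qed.

Definition orbit_jet (a : R) (k : nat) (x : R) : R :=
  jet_eval (iter k jet_deriv JPos) (orbit a x) (speed a (orbit a x)).

Lemma is_derive_orbit_jet a k (x : R) : 0 < a ->
  is_derive x 1 (orbit_jet a k) (orbit_jet a k.+1 x).
Proof.
move=> a0; apply: (@is_derive_jet (orbit a) (fun x => speed a (orbit a x))) => y.
- exact: is_derive_orbit.
- exact: is_derive_speed_orbit.
Qed.

Lemma smooth_chain_orbit_jet S a : 0 < a -> smooth_chain S (orbit_jet a).
Proof. by move=> a0 k; apply: deriv_within_is_derive => x; exact: is_derive_orbit_jet. Qed.

Lemma smooth_chain_scaled_orbit_jet S a beta : 0 < a ->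
  smooth_chain S (fun k x => beta^-1 ^+ k * orbit_jet a k (beta^-1 * x)).
Proof.
move=> a0 k; apply: deriv_within_is_derive => x.
have h := is_derive1_comp (f := orbit_jet a k) (g := fun y => beta^-1 * y)
  (is_derive_orbit_jet k _ a0) (is_derive_scale beta^-1 x).
have := is_derive1_comp (f := fun y => beta^-1 ^+ k * y)
  (g := fun y => orbit_jet a k (beta^-1 * y)) (is_derive_scale _ _) h.
rewrite (_ : _ ^+ k.+1 * _ = beta^-1 ^+ k * (orbit_jet a k.+1 (beta^-1 * x) * beta^-1)) //.
by rewrite exprS; ring.
Qed.

End Jet.

(** * Stability of the pendulum equation in the initial velocity *)

Section Gronwall.
Context {R : realType}.

(** The derivative cos^2 - sin^2 has absolute value at most 1. *)
Lemma sin_cos_lipschitz (s t : R) : `|sin s * cos s - sin t * cos t| <= `|s - t|.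
Proof.
have d (x : R) : is_derive x 1 (fun y => sin y * cos y) (cos x ^+ 2 - sin x ^+ 2).
  have := is_deriveM (is_derive_sin x) (is_derive_cos x).
  by rewrite /GRing.scale /= mulrN addrC -!expr2.
have [c _ ->] := MVT_between t s d.
rewrite normrM ler_piMl // ler_norml.
have := cos2Dsin2 c; have := sqr_ge0 (cos c); have := sqr_ge0 (sin c).
by move=> *; apply/andP; split; lra.
Qed.

(** With d and v the differences of positions and velocities, (d^2 + v^2) e^(-2y) is nonincreasing,
    because its derivative is at most (4|d||v| - 2(d^2 + v^2)) e^(-2y). It yields uniqueness when a
    = alpha and continuous dependence otherwise. *)
Lemma orbit_gronwall (a alpha : R) (phi0 phi0' phi0'' : R -> R) : 0 < a ->
  deriv_within `[0, +oo[ phi0 phi0' -> deriv_within `[0, +oo[ phi0' phi0'' ->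
  (forall x : R, 0 <= x -> phi0'' x = sin (phi0 x) * cos (phi0 x)) ->
  phi0 0 = 0 -> phi0' 0 = alpha -> forall x, 0 <= x ->
  (orbit a x - phi0 x) ^+ 2 + (speed a (orbit a x) - phi0' x) ^+ 2
  <= (a - alpha) ^+ 2 * expR (2 * x).
Proof.
move=> a0 d1 d2 ode p0 p1 x x0.
pose d y := orbit a y - phi0 y; pose v y := speed a (orbit a y) - phi0' y.
pose e y := (d y * d y + v y * v y) * expR (- 2 * y).
pose r y := sin (orbit a y) * cos (orbit a y) - sin (phi0 y) * cos (phi0 y).
have de (y : R) : 0 < y -> is_derive y 1 e
    ((2 * (d y * v y) + 2 * (v y * r y) - 2 * (d y * d y + v y * v y)) * expR (- 2 * y)).
  move=> y0.
  have dd : is_derive y 1 d (v y).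
    exact: is_deriveB (is_derive_orbit a0 y) (deriv_within_ray_is_derive d1 y0).
  have dv : is_derive y 1 v (r y).
    rewrite /r -ode ?ltW //.
    exact: is_deriveB (is_derive_speed_orbit a0 y) (deriv_within_ray_is_derive d2 y0).
  have dx := is_derive1_comp (is_derive_expR (- 2 * y)) (is_derive_scale (- 2) y).
  have ds := is_deriveD (is_deriveM dd dd) (is_deriveM dv dv).
  have := is_deriveM ds dx; rewrite /GRing.scale /=.
  set l := (X in is_derive _ _ _ X -> _) => h; apply: is_derive_eq.
  by rewrite /l (_ : (d * d + v * v) y = d y * d y + v y * v y) //; ring.
(* At 0 the derivatives of [phi0] and [phi0'] are one-sided, so monotonicity is derived from the
   open ray and continuity up to 0. *)
have ce : {within `[0, +oo[, continuous e}.
  have cphi := deriv_within_ray_continuous d1; have cphi' := deriv_within_ray_continuous d2.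
  have co : {within `[0, +oo[, continuous (orbit a)}.
    by apply: continuous_subspaceT; exact: orbit_continuous.
  have cs : {within `[0, +oo[, continuous (fun y => speed a (orbit a y))}.
    by apply: continuous_subspaceT; exact: is_derive_continuous (is_derive_speed_orbit a0).
  have cx : {within `[0, +oo[, continuous (fun y => expR (- 2 * y) : R)}.
    apply: continuous_subspaceT.
    apply: (@is_derive_continuous R _ (fun y => expR (- 2 * y) * - 2)) => y.
    exact: is_derive1_comp (is_derive_expR (- 2 * y)) (is_derive_scale (- 2) y).
  have cd : {within `[0, +oo[, continuous d}.
    by move=> y; apply: cvgB; [exact: co|exact: cphi].
  have cv : {within `[0, +oo[, continuous v}.
    by move=> y; apply: cvgB; [exact: cs|exact: cphi'].
  move=> y; apply: cvgM; last exact: cx.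
  by apply: cvgD; apply: cvgM; (exact: cd || exact: cv).
have := @ler0_derive1_nincry R e 0 _ _ ce 0 x (lexx 0) x0.
have -> : e 0 = (a - alpha) ^+ 2.
  rewrite /e /d /v orbit0 // p0 p1 mulr0 expR0 /speed sin0 expr0n addr0 sqrtr_sqr.
  by rewrite ger0_norm ?ltW //; ring.
have -> : (orbit a x - phi0 x) ^+ 2 + (speed a (orbit a x) - phi0' x) ^+ 2 = e x * expR (2 * x).
  by rewrite /e -mulrA -expRD mulNr addNr expR0 mulr1 !expr2.
move=> h; rewrite ler_wpM2r ?expR_ge0 //; apply: h => y.
  by rewrite in_itv /= andbT => y0; case: (de y y0).
rewrite in_itv /= andbT => y0; have dey := de y y0; rewrite derive1E derive_val.
rewrite mulr_le0_ge0 ?expR_ge0 //.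
have : `|r y| <= `|d y| by exact: sin_cos_lipschitz.
have : v y * r y <= `|v y| * `|r y| by rewrite -normrM ler_norm.
have : d y * v y <= `|d y| * `|v y| by rewrite -normrM ler_norm.
have : `|d y| * `|d y| = d y * d y by rewrite -!expr2 real_normK ?num_real.
have : `|v y| * `|v y| = v y * v y by rewrite -!expr2 real_normK ?num_real.
have := normr_ge0 (v y); move: `|v y| `|d y| `|r y| => V D Q V0 eV eD h1 h2 h3.
have h4 : V * Q <= V * D by rewrite ler_wpM2l.
have := sqr_ge0 (V - D); rewrite -eV -eD; nra.
Qed.

End Gronwall.

(** * Estimates uniform over the minimizers for small beta *)

Section Asymptotics.
Context {R : realType}.

Lemma sqr_le_norm (x y : R) : 0 <= y -> x ^+ 2 <= y ^+ 2 -> `|x| <= y.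
Proof. by move=> y0 h; rewrite -(@ler_pXn2r _ 2) ?nnegrE // real_normK ?num_real. Qed.

Lemma minimizer_orbit_near (kt alpha eta : R) : 0 < kt -> 0 < alpha ->
  action alpha (pi / 2) = kt * pi -> 0 < eta ->
  exists2 delta : R, 0 < delta & forall beta : R, 0 < beta -> beta < delta ->
  forall phi g : R -> R, minimizer beta (kt / beta) phi g ->
  exists a : R, [/\ 0 < a, `|a - alpha| <= eta,
    forall x : R, 0 <= x -> x <= 1 -> phi x = orbit a (beta^-1 * x) &
    `|8 * beta ^+ 2 * Fbk beta (kt / beta) phi g + alpha ^+ 2|
      <= 2 * beta * oscillation kt alpha].
Proof.
move=> k0 al0 alE eta0.
have o0 := oscillation_gt0 k0 al0; have r0 := rigidity_gt0 al0.
have o2 : 0 < 2 * oscillation kt alpha by rewrite pmulr_rgt0.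
have o4 : 0 < 4 * oscillation kt alpha by rewrite pmulr_rgt0.
(* The first threshold is the smallness condition of [minimizer_orbit]; the second turns its bound 4
   beta [oscillation] into |a - alpha| <= eta. *)
exists (Num.min (alpha ^+ 2 / (2 * oscillation kt alpha))
    ((rigidity alpha * eta) ^+ 2 / (4 * oscillation kt alpha))).
  by rewrite lt_min !divr_gt0 // exprn_gt0 // mulr_gt0.
move=> beta b0; rewrite lt_min (ltr_pdivlMr _ _ o2) (ltr_pdivlMr _ _ o4) => /andP[b1 b2] phi g m.
have small : 2 * beta * oscillation kt alpha < alpha ^+ 2 by lra.
have [a [a0 ha hphi hF]] := minimizer_orbit k0 al0 alE b0 small m.
exists a; split => //; rewrite -(ler_pM2l r0) -[X in X * `|_|]gtr0_norm // -normrM.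
by apply: sqr_le_norm; [rewrite mulr_ge0 ?ltW|lra].
Qed.

Lemma orbit_bounded (M L b x : R) : 0 < b -> b <= M -> 0 <= x -> x <= L ->
  `|orbit b x| <= (M + 1) * (L + 1) /\ `|speed b (orbit b x)| <= (M + 1) * (L + 1).
Proof.
move=> b0 bM x0 xL; rewrite !ger0_norm ?speed_ge0 ?orbit_ge0 //.
have := orbit_le b0 x0; have := speed_le (orbit b x) (ltW b0) => q1 q2.
by split; [apply: (le_trans q2)|apply: (le_trans q1)]; nra.
Qed.

(** The Gronwall estimate controls position and velocity on [0, L], and the Lipschitz bound on a box
    transfers it to every derivative. *)
Lemma orbit_jet_close (alpha L eps : R) (k : nat) : 0 < alpha -> 0 < L -> 0 < eps ->
  exists2 eta : R, 0 < eta & forall a : R, 0 < a -> `|a - alpha| <= eta ->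
  forall x : R, 0 <= x -> x <= L -> `|orbit_jet a k x - orbit_jet alpha k x| < eps.
Proof.
move=> al0 L0 e0.
(* The box of [orbit_bounded] with M = alpha + 1, which covers all [a] within 1 of [alpha]. *)
have [K K0 hK] := @jet_eval_lipschitz R (iter k jet_deriv JPos) ((alpha + 1 + 1) * (L + 1)).
have K1 : 0 < K + 1 by rewrite ltr_wpDl.
have x0 : 0 < expR L by exact: expR_gt0.
pose z := 2 * (K + 1) * expR L; have z0 : 0 < z by rewrite !mulr_gt0.
exists (Num.min 1 (eps / z)); first by rewrite lt_min ltr01 divr_gt0.
move=> a a0; rewrite le_min ler_pdivlMr // => /andP[h1 hz] x xge xL.
have gr := orbit_gronwall a0
  (deriv_within_is_derive (S := `[0, +oo[%classic) (is_derive_orbit al0))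
  (deriv_within_is_derive (S := `[0, +oo[%classic) (is_derive_speed_orbit al0))
  (fun _ _ => erefl) (orbit0 al0).
have sa0 : speed alpha (orbit alpha 0) = alpha.
  by rewrite orbit0 // /speed sin0 expr0n addr0 sqrtr_sqr gtr0_norm.
have {}gr := gr _ sa0 x xge.
have E2 : (a - alpha) ^+ 2 * expR (2 * x) <= (`|a - alpha| * expR L) ^+ 2.
  rewrite exprMn real_normK ?num_real // ler_wpM2l ?sqr_ge0 //.
  by rewrite expr2 -expRD ler_expR mulr_natl mulr2n lerD.
have nn : 0 <= `|a - alpha| * expR L by rewrite mulr_ge0 // ltW.
have gd : `|orbit a x - orbit alpha x| <= `|a - alpha| * expR L.
  apply: sqr_le_norm => //; apply: le_trans (le_trans gr E2).
  by rewrite lerDl sqr_ge0.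
have gv : `|speed a (orbit a x) - speed alpha (orbit alpha x)| <= `|a - alpha| * expR L.
  apply: sqr_le_norm => //; apply: le_trans (le_trans gr E2).
  by rewrite lerDr sqr_ge0.
have aM : a <= alpha + 1 by rewrite -lerBlDl (le_trans (ler_norm _)).
have [p1 p2] := orbit_bounded a0 aM xge xL.
have [|p3 p4] := orbit_bounded al0 _ xge xL (M := alpha + 1); first by rewrite lerDl.
have [_ h] := hK _ _ _ _ p1 p2 p3 p4; apply: (le_lt_trans h).
apply: (@le_lt_trans _ _ (K * (2 * (`|a - alpha| * expR L)))).
  by rewrite ler_wpM2l // mulr_natl mulr2n lerD.
(* The strict inequality comes from K < K + 1 in [z], which requires a nonzero |a - alpha|; the zero
   case is immediate. *)
have [->|an] := eqVneq (`|a - alpha|) 0; first by rewrite mul0r !mulr0.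
have an0 : 0 < 2 * (`|a - alpha| * expR L) by rewrite !mulr_gt0 // lt_def an normr_ge0.
apply: lt_le_trans hz; rewrite (_ : `|a - alpha| * z =
  K * (2 * (`|a - alpha| * expR L)) + 2 * (`|a - alpha| * expR L)); first by rewrite ltrDl.
by rewrite /z; ring.
Qed.

(** T is beta times the travel time P over one period, and pi/(a+1) <= P <= pi/a with [a] between
    alpha/2 and 3 alpha/2. *)
Lemma orbit_period (alpha beta a : R) (phi : R -> R) : 0 < alpha -> 0 < beta ->
  beta < alpha / (4 * pi) -> 0 < a -> `|a - alpha| <= alpha / 2 ->
  (forall x : R, 0 <= x -> x <= 1 -> phi x = orbit a (beta^-1 * x)) ->
  exists T : R,
  [/\ 0 < T /\ T < 1, phi T = pi,
      (forall T' : R, 0 < T' -> T' < 1 -> phi T' = pi -> T' = T),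
      (forall x : R, 0 <= x -> x <= 1 - T -> phi (x + T) = pi + phi x)
    & alpha / (4 * pi) / beta <= (Num.floor (T^-1))%:~R /\
      (Num.floor (T^-1))%:~R <= ((3 / 2 * alpha + 1) / pi) / beta].
Proof.
move=> al0 b0 bs a0 ha hphi; have p0 := pi_gt0 R.
have bn : beta != 0 by rewrite gt_eqF.
pose P := travel_time a pi; exists (beta * P).
have := travel_time_increment_le a0 (ltW p0); have := travel_time_increment_ge a0 (ltW p0).
rewrite travel_time0 // !subr0 -/P ![_^-1 * _]mulrC => Pge Ple.
have a1 : 0 < a + 1 by rewrite addr_gt0.
have P0 : 0 < P by apply: lt_le_trans Pge; rewrite divr_gt0.
have [ha1 ha2] : alpha / 2 <= a /\ a <= 3 / 2 * alpha.
  by move: ha; rewrite ler_norml => /andP[]; split; lra.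
rewrite ler_pdivrMr // in Pge; rewrite ler_pdivlMr // in Ple.
rewrite ltr_pdivlMr ?mulr_gt0 // in bs.
have Pa : P * (alpha / 2) <= pi by apply: le_trans Ple; rewrite ler_pM2l.
have T0 : 0 < beta * P by exact: mulr_gt0.
(* From beta < alpha/(4 pi) and P <= 2 pi/alpha. *)
have T1 : beta * P * 2 <= 1.
  rewrite -(ler_pM2r p0) -(ler_pM2r al0) mul1r.
  have : beta * pi * (P * (alpha / 2)) <= beta * pi * pi by rewrite ler_pM2l // mulr_gt0.
  have : beta * (4 * pi) * pi <= alpha * pi by rewrite ler_pM2r // ltW.
  nra.
have T2 : beta * P < 1 by lra.
have TE x : beta^-1 * (x + beta * P) = beta^-1 * x + P by field.
have phiT : phi (beta * P) = pi.
  by rewrite hphi ?(ltW T0) ?(ltW T2) // mulKf // travel_timeK.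
split => //.
- move=> t t0 t1; rewrite hphi ?(ltW t0) ?(ltW t1) // => /(congr1 (travel_time a)).
  by rewrite orbitK // -/P => <-; rewrite mulVKf.
- move=> x x0 xT; rewrite !hphi ?addr_ge0 ?(ltW T0) //; [|lra|lra].
  by rewrite TE orbit_pi // addrC.
have i0 : 0 < (beta * P)^-1 by rewrite invr_gt0.
have i1 : beta * P * (beta * P)^-1 = 1 by rewrite divff // gt_eqF.
split.
(* The integer part loses at most 1 <= alpha/(4 pi beta), which is half of the lower bound alpha/(2
   pi beta) for 1/T. *)
- have : (beta * P)^-1 < (Num.floor (beta * P)^-1 + 1)%:~R by exact: lt_succ_floor.
  rewrite intrD => h; rewrite ler_pdivrMr // ler_pdivrMr ?mulr_gt0 //.
  have fl : (beta * P)^-1 - 1 <= (Num.floor (beta * P)^-1)%:~R by lra.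
  have bp : 0 < beta * (4 * pi) by rewrite !mulr_gt0.
  apply: (@le_trans _ _ (((beta * P)^-1 - 1) * beta * (4 * pi))); last first.
    by rewrite -!mulrA ler_pM2r.
  have e : (beta * P)^-1 * beta * (4 * pi) = 4 * pi / P by field; rewrite !gt_eqF.
  have : 2 * alpha <= 4 * pi / P by rewrite ler_pdivlMr //; lra.
  rewrite -e; lra.
- apply: (le_trans (floor_le _)).
  rewrite ler_pdivlMr // ler_pdivlMr // -(ler_pM2r P0).
  have -> : (beta * P)^-1 * beta * pi * P = pi by field; rewrite !gt_eqF.
  apply: (le_trans Pge); rewrite [leRHS]mulrC ler_pM2l //; lra.
Qed.

End Asymptotics.

(** * Choice of the constants and assembly of the claims *)

Theorem theorem2 (R : realType) (kt : R) (hkt : pi^-1 < kt) :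
  exists beta0 : R, 0 < beta0 /\
  exists c C M : R, [/\ 0 < c, c < C & 0 <= M] /\
  exists alpha0 : R,
    (* alpha0 is the unique number in (0, 2 kt] with the integral identity *)
    [/\ 0 < alpha0, alpha0 <= 2 * kt,
        \int[@lebesgue_measure R]_(y in `[0%R, pi / 2])
            Num.sqrt (alpha0 ^+ 2 + (sin y) ^+ 2) = kt * pi
      & forall a : R, 0 < a -> a <= 2 * kt ->
          \int[@lebesgue_measure R]_(y in `[0%R, pi / 2])
            Num.sqrt (a ^+ 2 + (sin y) ^+ 2) = kt * pi -> a = alpha0] /\
    (* properties of every minimizer, for beta small *)
    (forall beta : R, 0 < beta -> beta < beta0 ->
     forall phi g : R -> R, minimizer beta (kt / beta) phi g ->
       [/\ exists T : R,
             [/\ 0 < T /\ T < 1, phi T = pi,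
                 (forall T' : R, 0 < T' -> T' < 1 -> phi T' = pi -> T' = T),
                 (forall x : R, 0 <= x -> x <= 1 - T -> phi (x + T) = pi + phi x)
               & c / beta <= (Num.floor (T^-1))%:~R /\
                 (Num.floor (T^-1))%:~R <= C / beta],
           `| Fbk beta (kt / beta) phi g - (- alpha0 ^+ 2 / (8 * beta ^+ 2)) |
              <= M / beta
         & exists D : nat -> R -> R,
             smooth_chain `[0%R, 1%R] D /\
             forall x, 0 <= x -> x <= 1 -> D 0%N x = phi x]) /\
    (* C^infty(K) convergence of x |-> phi_beta(beta x) to phi0, K = [0, L] *)
    (forall phi0 phi0' phi0'' : R -> R,
       deriv_within `[0%R, +oo[ phi0 phi0' ->
       deriv_within `[0%R, +oo[ phi0' phi0'' ->
       (forall x : R, 0 <= x -> phi0'' x = sin (phi0 x) * cos (phi0 x)) ->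
       phi0 0 = 0 -> phi0' 0 = alpha0 ->
       exists D0 : nat -> R -> R,
         [/\ smooth_chain `[0%R, +oo[ D0,
             (forall x : R, 0 <= x -> D0 0%N x = phi0 x)
           & forall (k : nat) (L eps : R), 0 < L -> 0 < eps ->
               exists delta : R, 0 < delta /\
               forall beta : R, 0 < beta -> beta < delta ->
               forall phi g : R -> R, minimizer beta (kt / beta) phi g ->
               forall D : nat -> R -> R,
                 smooth_chain `[0%R, 1%R] D ->
                 (forall x, 0 <= x -> x <= 1 -> D 0%N x = phi x) ->
                 forall x : R, 0 <= x -> x <= L ->
                   `| beta ^+ k * D k (beta * x) - D0 k x | < eps]).
Proof.
have p0 := pi_gt0 R.
have k0 : 0 < kt by apply: lt_trans hkt; rewrite invr_gt0.
have [alpha [al0 al2 alE]] := action_param_ex hkt.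
have half : 0 <= pi / 2 :> R by exact/ltW/pi_half_gt0.
have intE (a : R) :
    \int[@lebesgue_measure R]_(y in `[0%R, pi / 2]) Num.sqrt (a ^+ 2 + (sin y) ^+ 2) =
    action a (pi / 2).
  rewrite (Rintegral_FTC2 half (is_derive_action a) (@speed_continuous R a)).
  by rewrite action0 subr0.
have [d d0 near] := minimizer_orbit_near k0 al0 alE (divr_gt0 al0 (ltr0n R 2)).
have o0 := oscillation_gt0 k0 al0.
exists (Num.min d (alpha / (4 * pi))).
split; first by rewrite lt_min d0 !divr_gt0 // mulr_gt0.
(* The first two constants are those of [orbit_period]; the third is 2 beta [oscillation] / (8
   beta^2) with the factor 1/beta removed. *)
exists (alpha / (4 * pi)), ((3 / 2 * alpha + 1) / pi), (oscillation kt alpha / 4).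
split.
  split; [by rewrite divr_gt0 // mulr_gt0| |by rewrite divr_ge0 // ltW].
  have -> : alpha / (4 * pi) = alpha / 4 / pi by rewrite invfM mulrA.
  by rewrite ltr_pM2r ?invr_gt0 //; lra.
exists alpha; split; first split => //; first by rewrite intE.
  move=> a a0 _; rewrite intE -alE.
  by apply: action_param_inj; [exact: pi_half_gt0|exact: ltW|exact: ltW].
split.
  move=> beta b0; rewrite lt_min => /andP[bd bs] phi g m.
  have [a [a0 ha hphi hF]] := near beta b0 bd phi g m.
  split.
  - exact: orbit_period al0 b0 bs a0 ha hphi.
  - have b2 : 0 < 8 * beta ^+ 2 by rewrite mulr_gt0 // exprn_gt0.
    rewrite -(ler_pM2l b2) -[X in X * `|_|]gtr0_norm // -normrM.
    rewrite (_ : 8 * beta ^+ 2 * (_ - _) = 8 * beta ^+ 2 * Fbk beta (kt / beta) phi g + alpha ^+ 2).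
      by apply: (le_trans hF); rewrite le_eqVlt; apply/orP; left; apply/eqP; field; rewrite gt_eqF.
    by field; rewrite gt_eqF.
  - exists (fun k x => beta^-1 ^+ k * orbit_jet a k (beta^-1 * x)).
    split; first exact: smooth_chain_scaled_orbit_jet.
    by move=> x x0 x1; rewrite expr0 mul1r hphi.
move=> phi0 phi0' phi0'' d1 d2 ode i0 i1; exists (orbit_jet alpha).
split; first exact: smooth_chain_orbit_jet.
  (* Gronwall with a = alpha identifies any solution [phi0] with the orbit of [alpha]. *)
  move=> x x0; have := orbit_gronwall al0 d1 d2 ode i0 i1 x0.
  rewrite subrr expr0n mul0r => h; apply/eqP; rewrite -subr_eq0 -sqrf_eq0 eq_le sqr_ge0 andbT.
  by apply: le_trans h; rewrite lerDl sqr_ge0.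
move=> k L eps L0 e0; have [eta eta0 close] := orbit_jet_close k al0 L0 e0.
have [d' d'0 near'] := minimizer_orbit_near k0 al0 alE eta0.
(* The bound 1/L places beta x in [0, 1] for all x <= L. *)
exists (Num.min d' L^-1); split; first by rewrite lt_min d'0 invr_gt0.
move=> beta b0; rewrite lt_min => /andP[bd bL] phi g m D cD D0 x x0 xL.
have [a [a0 ha hphi _]] := near' beta b0 bd phi g m.
have bx : beta * x <= 1.
  have := ltW bL; rewrite -(ler_pM2r L0) mulVf ?gt_eqF //; apply: le_trans.
  by rewrite ler_pM2l.
have bx0 : 0 <= beta * x by rewrite mulr_ge0 // ltW.
have cE := @smooth_chain_scaled_orbit_jet R `[0, 1]%classic a beta a0.
(* For the explicit chain, beta^k cancels the scaling factor and leaves the jet of the orbit of [a]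
   at x. *)
rewrite (smooth_chain_unique cD cE) // => [|y y0 y1]; last by rewrite D0 // expr0 mul1r hphi.
have bn : beta != 0 by rewrite gt_eqF.
by rewrite mulKf // exprVn mulVKf ?expf_neq0 //; exact: close.
Qed.
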